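(* For any $d\in\mathbb{N}^*$ and $R_\mu,R_\nu,M>0$, there is $C>0$ such that the following holds. Let $\mu$ and $\nu$ be probability measures on $\mathbb{R}^d$ supported on $B_{R_\mu}$ and $B_{R_\nu}$ respectively, with $\mu(A)\le M\lambda(A)$ for any measurable set $A\subset\mathbb{R}^d$. Let $\bar\varphi\in\mathcal{C}_{4R_\mu,4R_\nu}$ be an optimal Brenier potential for $(\mu,\nu)$ and let $\gamma$ be their optimal coupling. Let $\tilde\mu,\tilde\nu$ be probability measures also supported on $B_{R_\mu}$ and $B_{R_\nu}$ respectively, with associated optimal Brenier potential $\tilde\phi\in\mathcal{C}_{4R_\mu,4R_\nu}$ and optimal coupling $\tilde\gamma$. Then $$\frac{1}{C^4}W_2(\gamma,\tilde\gamma)^4\le W_2(\mu,\tilde\mu)+\left(\int(\bar\varphi-\tilde\phi)\,d\tilde\mu+\int(\bar\varphi^*-\tilde\phi^* )\,d\tilde\nu\right)^{\frac12}.$$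
   Context: $B_r$ is the open Euclidean ball of $\mathbb{R}^d$ centered at $0$ with radius $r$; $\lambda$ is the Lebesgue measure. $\Gamma_0(\mathbb{R}^d)$ is the set of proper lower semicontinuous convex functions $\mathbb{R}^d\to\mathbb{R}\cup\{+\infty\}$; $\varphi^*(y)=\sup_{x}\langle x,y\rangle-\varphi(x)$. For $r,s>0$, $\mathcal{C}_{r,s}=\{\varphi\in\Gamma_0(\mathbb{R}^d)\mid\varphi \text{ is } s\text{-Lipschitz on } B_r,\ \varphi^* \text{ is } r\text{-Lipschitz on } B_s\}$. An optimal Brenier potential for a pair $(\alpha,\beta)$ of compactly supported probability measures is a $\varphi\in\Gamma_0(\mathbb{R}^d)$ attaining $\inf_{\varphi\in\Gamma_0(\mathbb{R}^d)}\int\varphi\,d\alpha+\int\varphi^*\,d\beta$. An optimal coupling for $(\alpha,\beta)$ is a minimizer of $\int\frac12\|x-y\|^2d\gamma(x,y)$ over probability measures $\gamma$ on $\mathbb{R}^d\times\mathbb{R}^d$ with marginals $\alpha$ and $\beta$. $W_2$ is the 2-Wasserstein distance for the Euclidean norm (on $\mathbb{R}^d$ or on $\mathbb{R}^d\times\mathbb{R}^d\simeq\mathbb{R}^{2d}$). *)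

(* Defs.v *)
From HB Require Import structures.
From mathcomp Require Import all_boot all_order all_algebra.
From mathcomp Require Import all_classical all_reals all_analysis.
From mathcomp Require Import measurable_realfun.

Set Implicit Arguments.
Unset Strict Implicit.
Unset Printing Implicit Defensive.

Import Order.TTheory GRing.Theory Num.Theory.
Import numFieldNormedType.Exports.

Local Open Scope classical_set_scope.
Local Open Scope ring_scope.

Section borel_rV.
Context (R : realType) (d : nat).

Definition borel_rV : set (set 'rV[R]_d) := <<s [set U | open U] >>.

Let borel_rV0 : borel_rV set0. Proof. exact: sigma_algebra0. Qed.

Let borel_rVC A : borel_rV A -> borel_rV (~` A).
Proof. exact: sigma_algebraC. Qed.

Let borel_rV_bigcup (F : (set 'rV[R]_d)^nat) :
  (forall i, borel_rV (F i)) -> borel_rV (\bigcup_i F i).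
Proof. exact: sigma_algebra_bigcup. Qed.

HB.instance Definition _ := @isMeasurable.Build
  (sigma_display [set U : set 'rV[R]_d | open U]) 'rV[R]_d
  borel_rV borel_rV0 borel_rVC borel_rV_bigcup.

End borel_rV.

(* The d-dimensional Lebesgue measure, as the iterated product of the
   one-dimensional one transported along R * R^d -> R^(d+1). *)
Fixpoint lebesgue_rV (R : realType) (d : nat) : set 'rV[R]_d -> \bar R :=
  match d with
  | 0 => fun A => \d_(0 : 'rV[R]_0) A
  | d'.+1 => pushforward (lebesgue_measure \x @lebesgue_rV R d')%E
      (fun p : R * 'rV[R]_d' => row_mx p.1%:M p.2 : 'rV[R]_(1 + d'))
  end.

Lemma lebesgue_rV_box (R : realType) (d : nat) (a b : 'rV[R]_d) :
  (forall i, a ord0 i <= b ord0 i) ->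
  lebesgue_rV [set x | forall i, a ord0 i <= x ord0 i <= b ord0 i] =
  (\prod_(i < d) (b ord0 i - a ord0 i))%:E.
Proof.
elim: d a b => [|d IH] a b ab.
  rewrite big_ord0 /= diracE mem_set//.
  by move=> [].
rewrite /= /pushforward /product_measure1 /=.
pose ta := \row_(i < d) a ord0 (lift ord0 i).
pose tb := \row_(i < d) b ord0 (lift ord0 i).
pose B := [set y : 'rV[R]_d | forall i, ta ord0 i <= y ord0 i <= tb ord0 i].
pose I : set (measurableTypeR R) := [set` `[a ord0 ord0, b ord0 ord0]].
transitivity (\int[lebesgue_measure]_x (lebesgue_rV B * (\1_I x)%:E))%E.
  apply: eq_integral => x _ /=; rewrite indicE.
  have row0 y : (row_mx x%:M y : 'rV[R]_(1 + d)) ord0 ord0 = x.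
    have -> : ord0 = lshift d (ord0 : 'I_1) :> 'I_(1 + d) by exact/val_inj.
    by rewrite row_mxEl mxE eqxx mulr1n.
  have rowS y i : (row_mx x%:M y : 'rV[R]_(1 + d)) ord0 (lift ord0 i) = y ord0 i.
    have -> : lift ord0 i = rshift 1 i :> 'I_(1 + d) by exact/val_inj.
    by rewrite row_mxEr.
  have [xI|xI] := boolP (x \in I).
    move: xI; rewrite inE /I /= in_itv /= => xI.
    rewrite mule1; congr lebesgue_rV; apply/seteqP; split => y.
      rewrite /xsection/= inE/= => h i; rewrite !mxE.
      by have := h (lift ord0 i); rewrite rowS.
    rewrite /xsection/= inE/= => h i; case: (unliftP ord0 i) => [j|] ->.
      by rewrite rowS; have := h j; rewrite !mxE.
    by rewrite row0.
  rewrite mule0 [X in lebesgue_rV X](_ : _ = set0).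
    suff : lebesgue_rV (set0 : set 'rV[R]_d) = 0%E by [].
    elim: (d) => [|n IHn] /=; first by rewrite diracE memNset.
    rewrite /pushforward preimage_set0 /product_measure1.
    by apply: integral0_eq => z _ /=; rewrite xsection0.
  rewrite -subset0 => y; rewrite /xsection/= inE/= => /(_ ord0).
  rewrite row0 => h; move/negP: xI; apply; apply/mem_set.
  by rewrite /I /= in_itv.
have -> : lebesgue_rV B = (\prod_(i < d) (tb ord0 i - ta ord0 i))%:E.
  by apply: IH => i; rewrite !mxE.
have mI : measurable I by exact: measurable_itv.
rewrite ge0_integralZl_EFin//; last 2 first.
- exact/measurable_EFinP/measurable_indic.
- by apply: prodr_ge0 => i _; rewrite !mxE subr_ge0.
rewrite integral_indic// setIT big_ord_recl.
rewrite [X in (_ * X)%E](_ : _ = (b ord0 ord0 - a ord0 ord0)%:E); last first.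
  rewrite [LHS]lebesgue_measure_itv/= lte_fin.
  by case: ltgtP (ab ord0) => // -> _; rewrite subrr.
rewrite EFinM muleC; congr (_ * _)%E.
by congr EFin; apply: eq_bigr => i _; rewrite !mxE.
Qed.

Section euclidean.
Context (R : realType) (d : nat).
Implicit Types x y : 'rV[R]_d.

Definition dotp x y : R := \sum_(i < d) x ord0 i * y ord0 i.

(* The library norm `|x| on 'rV[R]_d is the sup norm, with the same topology. *)
Definition eucl_norm x : R := Num.sqrt (dotp x x).

Definition eucl_dist x y : R := eucl_norm (x - y).

Definition eucl_ball (r : R) : set 'rV[R]_d := [set x | eucl_norm x < r].

Definition eucl_dist_prod (p q : 'rV[R]_d * 'rV[R]_d) : R :=
  Num.sqrt (eucl_dist p.1 q.1 ^+ 2 + eucl_dist p.2 q.2 ^+ 2).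

End euclidean.

Section convex_analysis.
Context (R : realType) (d : nat).
Local Open Scope ereal_scope.
Implicit Types phi : 'rV[R]_d -> \bar R.

Definition eproper phi := (forall x, phi x != -oo) /\ exists x, phi x != +oo.

Definition econvex phi := forall (x y : 'rV[R]_d) (t : R), (0 <= t <= 1)%R ->
  phi (t *: x + (1 - t) *: y)%R <= t%:E * phi x + (1 - t)%:E * phi y.

Definition Gamma0 : set ('rV[R]_d -> \bar R) :=
  [set phi | [/\ eproper phi, lower_semicontinuous phi & econvex phi]].

Definition fenchel_conj phi (y : 'rV[R]_d) : \bar R :=
  ereal_sup [set (dotp x y)%:E - phi x | x in [set: 'rV[R]_d]].

Definition lipschitz_real_on (k : R) (A : set 'rV[R]_d) phi :=
  (forall x, A x -> phi x \is a fin_num) /\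
  (forall x y, A x -> A y -> `|phi x - phi y| <= (k * eucl_dist x y)%:E).

Definition lipschitz_class (r s : R) : set ('rV[R]_d -> \bar R) :=
  [set phi | [/\ Gamma0 phi, lipschitz_real_on s (@eucl_ball R d r) phi
             & lipschitz_real_on r (@eucl_ball R d s) (fenchel_conj phi)]].

End convex_analysis.

Section transport.
Local Open Scope ereal_scope.

Definition concentrated_on d (T : measurableType d) (R : realType)
  (P : probability T R) (A : set T) := P (~` A) = 0.

Definition coupling d1 d2 (T1 : measurableType d1) (T2 : measurableType d2)
    (R : realType) (P : probability T1 R) (Q : probability T2 R) :
    set (probability (T1 * T2)%type R) :=
  [set g | (forall A, measurable A -> g (fst @^-1` A) = P A) /\
           (forall B, measurable B -> g (snd @^-1` B) = Q B)].

Definition W2 d (T : measurableType d) (R : realType) (dist : T -> T -> R)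
    (P Q : probability T R) : \bar R :=
  sqrte (ereal_inf [set \int[g]_z (dist z.1 z.2 ^+ 2)%:E | g in coupling P Q]).

Context (R : realType) (d : nat).
Implicit Types alpha beta : probability 'rV[R]_d R.

Definition brenier_functional alpha beta (phi : 'rV[R]_d -> \bar R) : \bar R :=
  \int[alpha]_x phi x + \int[beta]_y fenchel_conj phi y.

Definition optimal_brenier_potential alpha beta (phi : 'rV[R]_d -> \bar R) :=
  Gamma0 phi /\ brenier_functional alpha beta phi =
    ereal_inf [set brenier_functional alpha beta psi | psi in @Gamma0 R d].

Definition quadratic_cost (g : probability ('rV[R]_d * 'rV[R]_d)%type R) :=
  \int[g]_z (2^-1 * eucl_dist z.1 z.2 ^+ 2)%:E.

Definition optimal_coupling alpha beta
    (g : probability ('rV[R]_d * 'rV[R]_d)%type R) :=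
  coupling alpha beta g /\
  forall g', coupling alpha beta g' -> quadratic_cost g <= quadratic_cost g'.

End transport.

(* Main.v *)
From HB Require Import structures.
Require Import Defs.
From mathcomp Require Import all_boot all_order all_algebra.
From mathcomp Require Import all_classical all_reals all_analysis.
From mathcomp Require Import measurable_realfun ring lra.
Set Implicit Arguments.
Unset Strict Implicit.
Unset Printing Implicit Defensive.
Import Order.TTheory GRing.Theory Num.Theory.
Import numFieldNormedType.Exports.
Local Open Scope classical_set_scope.
Local Open Scope ring_scope.

(** Why the estimate holds.  Write e(x, y) = phi x + phi^* y - <x, y> >= 0 for
    the duality gap of phi, and b = Rnu.

    _Complementarity._  An optimal coupling is concentrated on a cyclically
    monotone set, hence on the graph of the subdifferential of a Rockafellar
    potential; comparing that potential with an optimal one shows that the gap of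
    the optimal potential vanishes almost everywhere for the optimal coupling
    [optimal_potential_complementary].  Applied to phi this gives y in the
    subdifferential of phi at x for gamma-almost every (x, y); applied to phit it
    turns the bracket of the statement into E = \int e d(gammat)
    [integral_duality_gap].

    _Pointwise bound._  Let f be the conjugate of phi^* restricted to the ball of
    radius b; it is finite, convex and b-Lipschitz on the whole space.  If y is a
    subgradient of f at x, and if y' is an approximate one at x' with error e,
    then testing both affine minorants at x + r u and x - r u yields
      r <y' - y, u> <= f(x + r u) + f(x - r u) - 2 f(x) + e + 2 b |x - x'|_1
    for every coordinate vector u, up to sign [subgradient_displacement].

    _Second differences._  Along a coordinate line, second differences of step r
    telescope to first differences, which are at most b r; integrated over a box
    they thus contribute O(r^2).  As mu has density at most M, the mu-integral of
    a second difference of f is O(r^2) as well [integral_second_diff_le].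

    _Conclusion._  Couplings of mu with mut, and gamma, gammat, can be glued into a
    coupling of gamma with gammat whose displacement in x is the one of the
    coupling of mu with mut, up to an arbitrarily small error [glue_couplings].
    Integrating the pointwise bound against it gives
      W_2(gamma, gammat)^2 <= C (r + (W + E) / r) + C W, W = W_2(mu, mut),
    and the choice of r of order (W + E)^(1/2) gives the exponent 4; the passage
    from E to its square root is harmless since W_2(gamma, gammat) is bounded. *)

(** * Finite sums and finite combinations of measures *)

Lemma sum_cyclic_shift (V : zmodType) (F : nat -> V) N : F N = F 0%N ->
  \sum_(i < N) F i.+1 = \sum_(i < N) F i.
Proof.
move=> FN; apply/eqP; rewrite -subr_eq0 -sumrB.
by rewrite -(big_mkord xpredT (fun i => F i.+1 - F i)) telescope_sumr// FN subrr.
Qed.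

Section measure_tools.
Local Open Scope ereal_scope.
Context d (T : measurableType d) (R : realType).

(** Gives a measure of total mass 1 the type [probability], so that couplings built
    inside a proof can compete with an optimal one. *)
Definition prob_of (m : {measure set T -> \bar R}) (m1 : m setT = 1) :
  set T -> \bar R := m.

HB.instance Definition _ (m : {measure set T -> \bar R}) (m1 : m setT = 1) :=
  Measure.on (prob_of m1).

HB.instance Definition _ (m : {measure set T -> \bar R}) (m1 : m setT = 1) :=
  Measure_isProbability.Build _ _ _ (prob_of m1) m1.

Definition fin_msum (I : finType) (m : I -> {measure set T -> \bar R}) :
    {measure set T -> \bar R} :=
  msum (fun j => if insub j is Some i then m (enum_val (i : 'I_#|I|))
                 else (mzero : {measure set T -> \bar R})) #|I|.

Lemma fin_msumE (I : finType) (m : I -> {measure set T -> \bar R}) A :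
  fin_msum m A = \sum_i m i A.
Proof.
rewrite (big_enum_val (A := I) (fun i => m i A)) /fin_msum /= /msum.
by apply: eq_bigr => i _; rewrite valK.
Qed.

Lemma ge0_integral_fin_msum (I : finType) (m : I -> {measure set T -> \bar R})
    (f : T -> \bar R) : (forall x, 0 <= f x) -> measurable_fun setT f ->
  \int[fin_msum m]_x f x = \sum_i \int[m i]_x f x.
Proof.
move=> f0 mf; rewrite /fin_msum ge0_integral_measure_sum//.
rewrite (big_enum_val (A := I) (fun i => \int[m i]_x f x)).
by apply: eq_bigr => i _; rewrite valK.
Qed.

Lemma le_integral_cst (m : {measure set T -> \bar R}) (A : set T)
    (f : T -> \bar R) (c : \bar R) :
  measurable A -> m (~` A) = 0 -> measurable_fun setT f ->
  (forall x, 0 <= f x) -> 0 <= c -> (forall x, A x -> f x <= c) ->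
  \int[m]_x f x <= c * m setT.
Proof.
move=> mA mA0 mf f0 c0 fc; rewrite -integral_cst//.
apply: ae_ge0_le_integral => //.
exists (~` A); split => //; first exact: measurableC.
by move=> x /= h Ax; apply: h => _; exact: fc.
Qed.

Lemma ge_integral_cst (m : {measure set T -> \bar R}) (A : set T)
    (f : T -> \bar R) (c : \bar R) :
  measurable A -> m (~` A) = 0 -> measurable_fun setT f ->
  (forall x, 0 <= f x) -> 0 <= c -> (forall x, A x -> c <= f x) ->
  c * m setT <= \int[m]_x f x.
Proof.
move=> mA mA0 mf f0 c0 fc; rewrite -integral_cst//.
apply: ae_ge0_le_integral => //.
exists (~` A); split => //; first exact: measurableC.
by move=> x /= h Ax; apply: h => _; exact: fc.
Qed.

Definition meas_add (m1 m2 : {measure set T -> \bar R}) :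
  {measure set T -> \bar R} := measure_add m1 m2.

Lemma meas_addE (m1 m2 : {measure set T -> \bar R}) A :
  meas_add m1 m2 A = m1 A + m2 A.
Proof. exact: measure_addE. Qed.

Lemma ge0_integral_meas_add (m1 m2 : {measure set T -> \bar R})
    (f : T -> \bar R) : (forall x, 0 <= f x) -> measurable_fun setT f ->
  \int[meas_add m1 m2]_x f x = \int[m1]_x f x + \int[m2]_x f x.
Proof. by move=> f0 mf; exact: ge0_integral_measure_add. Qed.

End measure_tools.

Definition push_measure d1 d2 (T1 : measurableType d1) (T2 : measurableType d2)
    (R : realType) (m : {measure set T1 -> \bar R}) (f : T1 -> T2)
    (mf : measurable_fun setT f) : {measure set T2 -> \bar R} :=
  measure_function_pushforward__canonical__measure_function_Measure m mf.

(** * Perturbing an optimal coupling along a cycle *)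

Section perturbation.
Local Open Scope ereal_scope.
Context d1 d2 (T1 : measurableType d1) (T2 : measurableType d2) (R : realType).

(** Moving a little mass of the coupling from the pieces W 0, ..., W (N - 1) to the
    products of the first marginal of W (i + 1) with the second marginal of W i
    changes neither marginal, because every piece loses once and gains once; so
    an optimal coupling cannot become cheaper.  As the cost nearly is a constant
    on each piece, this is cyclical monotonicity at the scale of the pieces. *)
Lemma coupling_cyclic_cells (alpha : probability T1 R) (beta : probability T2 R)
    (g : probability (T1 * T2)%type R) (c : T1 * T2 -> R)
    (N : nat) (W : nat -> set (T1 * T2)) (lo up : nat -> R) :
  coupling alpha beta g ->
  measurable_fun setT c -> (forall z, (0 <= c z)%R) ->
  \int[g]_z (c z)%:E < +oo ->
  (forall g', coupling alpha beta g' ->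
     \int[g]_z (c z)%:E <= \int[g']_z (c z)%:E) ->
  (0 < N)%N -> (forall i, measurable (W i)) -> (forall i, 0 < g (W i)) ->
  W N = W 0%N -> (forall i, (0 <= lo i)%R) -> (forall i, (0 <= up i)%R) ->
  (forall i z, W i z -> (lo i <= c z)%R) ->
  (forall i z z', W i z -> W i.+1 z' -> (c (z'.1, z.2) <= up i)%R) ->
  (\sum_(i < N) lo i <= \sum_(i < N) up i)%R.
Proof.
move=> [gA gB] mc c0 cfin gopt N0 mW W0 WN lo0 up0 cl cu.
have gE A : measurable A -> g A = (fine (g A))%:E.
  by move=> mA; rewrite fineK// fin_num_measure.
pose w i := fine (g (W i)).
have gW i : g (W i) = (w i)%:E by exact: gE.
have w0 i : (0 < w i)%R by rewrite -lte_fin -gW.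
have wN : w N = w 0%N by rewrite /w WN.
(* Each piece gives up the mass kappa; the bound makes the weights below nonnegative. *)
have [kappa [kappa0 kappaw]] : exists e : R, (0 < e)%R /\
    forall i, (i < N)%N -> (e / w i <= N%:R^-1)%R.
  have [e [e0 ew]] : exists e : R, (0 < e)%R /\
      forall i, (i < N)%N -> (e <= w i)%R.
    elim: (N) => [|n [e [e0 ew]]]; first by exists 1%R.
    exists (Num.min e (w n)); split; first by rewrite lt_min e0 w0.
    move=> i; rewrite ltnS leq_eqVlt => /predU1P[->|/ew h].
      by rewrite ge_min lexx orbT.
    by rewrite ge_min h.
  exists (e / N%:R)%R; split; first by rewrite divr_gt0// ltr0n.
  move=> i iN; rewrite mulrAC ler_piMl ?invr_ge0 ?ler0n//.
  by rewrite ler_pdivrMr// mul1r; exact: ew.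
pose t i := (kappa / w i)%R.
have t0 i : (0 <= t i)%R by rewrite /t divr_ge0// ltW.
have tw i : (t i * w i)%R = kappa by rewrite /t divfK// gt_eqF.
have tN (i : 'I_N) : (0 <= N%:R^-1 - t i)%R by rewrite subr_ge0 kappaw.
have N1 : (0 <= N%:R^-1 :> R)%R by rewrite invr_ge0.
pose X (p : (T1 * T2) * (T1 * T2)) := (p.1.1, p.2.2).
have mX : measurable_fun setT X.
  apply/measurable_fun_pairP; split => /=.
    exact: (measurableT_comp measurable_fst measurable_fst).
  exact: (measurableT_comp measurable_snd measurable_snd).
have mWC i : measurable (~` W i) by exact: measurableC.
(* The mass removal is written without subtraction, by splitting g into N equal
   parts and restricting the i-th one to W i and to its complement. *)
pose m1 (i : 'I_N) : {measure set (T1 * T2) -> \bar R} :=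
  mscale (NngNum N1) (mrestr g (mWC i)).
pose m2 (i : 'I_N) : {measure set (T1 * T2) -> \bar R} :=
  mscale (NngNum (tN i)) (mrestr g (mW i)).
have tw0 (i : 'I_N) : (0 <= t i / w i.+1)%R by rewrite divr_ge0// ltW.
pose push (i : 'I_N) : {measure set (T1 * T2) -> \bar R} :=
  push_measure (mrestr g (mW i.+1) \x mrestr g (mW i)) mX.
pose m3 (i : 'I_N) : {measure set (T1 * T2) -> \bar R} :=
  mscale (NngNum (tw0 i)) (push i).
(* m is the competitor, m' recomposes g itself. *)
pose m4 (i : 'I_N) : {measure set (T1 * T2) -> \bar R} :=
  mscale (NngNum (t0 i)) (mrestr g (mW i)).
pose base : {measure set (T1 * T2) -> \bar R} :=
  meas_add (fin_msum m1) (fin_msum m2).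
pose m : {measure set (T1 * T2) -> \bar R} := meas_add base (fin_msum m3).
pose m' : {measure set (T1 * T2) -> \bar R} := meas_add base (fin_msum m4).
pose q A := fine (g A).
have gq A : measurable A -> g A = (q A)%:E by exact: gE.
have baseE A : measurable A ->
    base A = (q A - \sum_(i < N) t i * q (A `&` W i))%:E.
  move=> mA; rewrite /base meas_addE !fin_msumE -big_split/=.
  rewrite (eq_bigr (fun i : 'I_N =>
      (N%:R^-1 * q A - t i * q (A `&` W i))%:E)); last first.
    move=> i _; rewrite /mscale/= /mrestr/= !gq; [|exact: measurableI..].
    rewrite -!EFinM -EFinD; congr EFin.
    have -> : q A = (q (A `&` W i) + q (A `&` ~` W i))%R.
      apply: EFin_inj; rewrite EFinD -!gq//; [|exact: measurableI..].
      rewrite -measureU; [|exact: measurableI..|].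
        by rewrite -setIUr setUv setIT.
      by rewrite setIACA setICr setI0.
    by ring.
  rewrite sumEFin; congr EFin; rewrite sumrB; congr (_ - _)%R.
  rewrite sumr_const card_ord -[LHS]mulr_natr mulrAC mulVf ?mul1r//.
  by rewrite pnatr_eq0 -lt0n.
have pushE i A B : measurable A -> measurable B ->
    push i (A `*` B) = (q (fst @^-1` A `&` W i.+1) * q (snd @^-1` B `&` W i))%:E.
  move=> mA mB; rewrite /push/= /pushforward/=.
  have mA' : measurable (fst @^-1` A : set (T1 * T2)).
    by rewrite -[X in measurable X]setTI; exact: measurable_fst.
  have mB' : measurable (snd @^-1` B : set (T1 * T2)).
    by rewrite -[X in measurable X]setTI; exact: measurable_snd.
  rewrite (_ : X @^-1` _ = (fst @^-1` A) `*` (snd @^-1` B)); last first.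
    by apply/seteqP; split => -[[a b] [a' b']].
  rewrite product_measure1E//.
  transitivity (g (fst @^-1` A `&` W i.+1) * g (snd @^-1` B `&` W i)) => //.
  by rewrite !gq//; exact: measurableI.
have m3E i A B : measurable A -> measurable B -> m3 i (A `*` B) =
    (t i / w i.+1 * (q (fst @^-1` A `&` W i.+1) * q (snd @^-1` B `&` W i)))%:E.
  by move=> mA mB; rewrite /m3 /= /mscale pushE.
have mfst A : measurable A -> m (fst @^-1` A) = g (fst @^-1` A).
  move=> mA; have mA' : measurable (fst @^-1` A : set (T1 * T2)).
    by rewrite -[X in measurable X]setTI; exact: measurable_fst.
  rewrite /m meas_addE baseE// fin_msumE [RHS]gq//.
  rewrite (eq_bigr (fun i : 'I_N =>
      (t i.+1 * q (fst @^-1` A `&` W i.+1))%:E)); last first.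
    move=> i _; rewrite (_ : fst @^-1` A = A `*` setT); last first.
      by apply/seteqP; split => -[a b]//= -[].
    rewrite m3E// preimage_setT setTI; congr EFin.
    rewrite (_ : A `*` setT = fst @^-1` A); last first.
      by apply/seteqP; split => -[a b]//= -[].
    by change (q (W i)) with (w i); rewrite /t; field; rewrite !gt_eqF.
  rewrite sumEFin -EFinD.
  by rewrite (sum_cyclic_shift (F := fun i => t i * q (fst @^-1` A `&` W i))%R) ?subrK// WN /t wN.
have msnd B : measurable B -> m (snd @^-1` B) = g (snd @^-1` B).
  move=> mB; have mB' : measurable (snd @^-1` B : set (T1 * T2)).
    by rewrite -[X in measurable X]setTI; exact: measurable_snd.
  rewrite /m meas_addE baseE// fin_msumE [RHS]gq//.
  rewrite (eq_bigr (fun i : 'I_N =>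
      (t i * q (snd @^-1` B `&` W i))%:E)); last first.
    move=> i _; rewrite (_ : snd @^-1` B = setT `*` B); last first.
      by apply/seteqP; split => -[a b]//= -[].
    rewrite m3E// preimage_setT setTI; congr EFin.
    rewrite (_ : setT `*` B = snd @^-1` B); last first.
      by apply/seteqP; split => -[a b]//= -[].
    by change (q (W i.+1)) with (w i.+1); field; rewrite gt_eqF.
  by rewrite sumEFin -EFinD subrK.
have mcpl : forall h : m setT = 1, coupling alpha beta (prob_of h).
  by move=> h; split => A mA; [rewrite -gA// -mfst|rewrite -gB// -msnd].
have m1T : m setT = 1.
  by rewrite -(preimage_setT (@fst T1 T2)) mfst// preimage_setT probability_setT.
have m'E A : measurable A -> m' A = g A.
  move=> mA; rewrite /m' meas_addE baseE// fin_msumE gq//.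
  rewrite (eq_bigr (fun i : 'I_N => (t i * q (A `&` W i))%:E)); last first.
    by move=> i _; rewrite /= /mscale/= /mrestr gq//; exact: measurableI.
  by rewrite sumEFin -EFinD subrK.
have mcE : measurable_fun setT (fun z => (c z)%:E) by exact/measurable_EFinP.
have ccost : \int[g]_z (c z)%:E = \int[base]_z (c z)%:E +
     \sum_i \int[m4 i]_z (c z)%:E.
  rewrite -ge0_integral_fin_msum// -?ge0_integral_meas_add//.
  by apply: eq_measure_integral => A mA _; rewrite m'E.
have mcost : \int[m]_z (c z)%:E = \int[base]_z (c z)%:E +
     \sum_i \int[m3 i]_z (c z)%:E.
  by rewrite ge0_integral_meas_add// ge0_integral_fin_msum.
have := gopt _ (mcpl m1T).
rewrite [X in _ <= X -> _]mcost ccost.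
have b0 : 0 <= \int[base]_z (c z)%:E by apply: integral_ge0 => z _; rewrite lee_fin.
have bfin : \int[base]_z (c z)%:E \is a fin_num.
  rewrite ge0_fin_numE//; apply: le_lt_trans cfin; rewrite ccost leeDl//.
  by apply: sume_ge0 => i _; apply: integral_ge0 => z _; rewrite lee_fin.
rewrite leeD2lE// => h.
have /le_trans : (\sum_(i < N) kappa * lo i)%:E <= \sum_i \int[m4 i]_z (c z)%:E.
  rewrite -sumEFin; apply: lee_sum => i _.
  have -> : (kappa * lo i)%:E = (lo i)%:E * m4 i setT.
    rewrite (_ : m4 i setT = (t i)%:E * g (setT `&` W i))//.
    by rewrite setTI gW [RHS](_ : _ = (lo i * (t i * w i))%:E)// tw mulrC.
  apply: (ge_integral_cst (A := W i)) => //; rewrite ?lee_fin//.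
  - rewrite (_ : m4 i (~` W i) = (t i)%:E * g (~` W i `&` W i))//.
    by rewrite setICl measure0 mule0.
  - by move=> z Wz; rewrite lee_fin; exact: cl.
move=> /(_ _ h)/le_trans.
have /[swap] /[apply] : \sum_i \int[m3 i]_z (c z)%:E <= (\sum_(i < N) kappa * up i)%:E.
  rewrite -sumEFin; apply: lee_sum => i _.
  have -> : (kappa * up i)%:E = (up i)%:E * m3 i setT.
    rewrite /m3/= /mscale/= -setXTT pushE// !preimage_setT !setTI.
    rewrite -!EFinM; congr EFin.
    change (q (W i.+1)) with (w i.+1); change (q (W i)) with (w i).
    by rewrite -(tw i); field; rewrite gt_eqF.
  pose D := [set z : T1 * T2 | (c z <= up i)%R].
  have mD : measurable D.
    rewrite (_ : D = setT `&` c @^-1` `]-oo, up i]); last first.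
      by rewrite setTI; apply/seteqP; split => z /=; rewrite in_itv.
    exact: mc.
  apply: (le_integral_cst (A := D)) => //; rewrite ?lee_fin//.
  rewrite (_ : m3 i (~` D) = (t i / w i.+1)%:E * push i (~` D))//.
  rewrite (_ : push i (~` D) = 0) ?mule0//.
  have mXD : measurable (X @^-1` ~` D).
    by rewrite -[X in measurable X]setTI; exact: (mX measurableT _ (measurableC mD)).
  have mWW : measurable (W i.+1 `*` W i) by exact: measurableX.
  apply/eqP; rewrite -measure_le0.
  have PT : (mrestr g (mW i.+1) \x mrestr g (mW i)) (~` (W i.+1 `*` W i)) = 0.
    have -> : ~` (W i.+1 `*` W i) = ((~` W i.+1) `*` setT) `|` (setT `*` (~` W i)).
      apply/seteqP; split => -[a b] /=.
        by move/not_andP => [?|?]; [left|right].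
      by move=> [[h1 _]|[_ h1]] [].
    have z1 : (mrestr g (mW i.+1) \x mrestr g (mW i)) ((~` W i.+1) `*` setT) = 0.
      rewrite product_measure1E//.
      transitivity (g (~` W i.+1 `&` W i.+1) * g (setT `&` W i)) => //.
      by rewrite setICl measure0 mul0e.
    have z2 : (mrestr g (mW i.+1) \x mrestr g (mW i)) (setT `*` (~` W i)) = 0.
      rewrite product_measure1E//.
      transitivity (g (setT `&` W i.+1) * g (~` W i `&` W i)) => //.
      by rewrite setICl measure0 mule0.
    apply/eqP; rewrite -measure_le0.
    apply: le_trans (measureU2 _ _ _) _; try exact: measurableX.
    by rewrite -[leRHS]adde0; apply: leeD; [rewrite -[leRHS]z1|rewrite -[leRHS]z2].
  rewrite -PT; apply: (le_measure (mrestr g (mW i.+1) \x mrestr g (mW i))).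
  - by rewrite inE.
  - by rewrite inE; exact: measurableC.
  by move=> [a b] /= + [Wa Wb]; apply; exact: cu Wb Wa.
by rewrite lee_fin -!mulr_sumr ler_pM2l.
Qed.

End perturbation.

(** * Inner product, l1 norm and measurability on row vectors *)

Section row_vectors.
Context (R : realType) (d : nat).
Implicit Types x y z : 'rV[R]_d.

Lemma dotpC x y : dotp x y = dotp y x.
Proof. by apply: eq_bigr => i _; rewrite mulrC. Qed.

Lemma dotpDl x y z : dotp (x + y) z = dotp x z + dotp y z.
Proof. by rewrite -big_split; apply: eq_bigr => i _; rewrite mxE mulrDl. Qed.

Lemma dotpZl (a : R) x y : dotp (a *: x) y = a * dotp x y.
Proof. by rewrite mulr_sumr; apply: eq_bigr => i _; rewrite mxE mulrA. Qed.

Lemma dotpBl x y z : dotp (x - y) z = dotp x z - dotp y z.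
Proof. by rewrite dotpDl -scaleN1r dotpZl mulN1r. Qed.

Lemma dotpBr x y z : dotp x (y - z) = dotp x y - dotp x z.
Proof. by rewrite dotpC dotpBl !(dotpC x). Qed.

Lemma dotp0l x : dotp 0 x = 0.
Proof. by rewrite -[0](subrr x) dotpBl subrr. Qed.

Lemma dotp_delta i x : dotp (delta_mx ord0 i) x = x ord0 i.
Proof.
rewrite /dotp (bigD1 i)//= mxE !eqxx mul1r big1 ?addr0// => j ji.
by rewrite mxE (negPf ji) andbF mul0r.
Qed.

Lemma dotp_ge0 x : 0 <= dotp x x.
Proof. by apply: sumr_ge0 => i _; exact: sqr_ge0. Qed.

Lemma eucl_dist_sqr x y :
  eucl_dist x y ^+ 2 = \sum_(i < d) (x ord0 i - y ord0 i) ^+ 2.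
Proof.
rewrite /eucl_dist /eucl_norm sqr_sqrtr ?dotp_ge0//.
by apply: eq_bigr => i _; rewrite !mxE.
Qed.

Lemma eucl_dist_sqrE x y :
  eucl_dist x y ^+ 2 = dotp x x + dotp y y - 2 * dotp x y.
Proof.
rewrite eucl_dist_sqr /dotp mulr_sumr -big_split -sumrB.
by apply: eq_bigr => i _ /=; ring.
Qed.

Lemma coordB x y i : (x - y) ord0 i = x ord0 i - y ord0 i.
Proof. by rewrite !mxE. Qed.

(** The displacement estimates are proved one coordinate at a time; this is the norm
    in which they add up. *)
Definition l1_norm x : R := \sum_(i < d) `|x ord0 i|.

Lemma l1_norm_ge0 x : 0 <= l1_norm x.
Proof. exact: sumr_ge0. Qed.

Lemma ler_dotp_l1 x y (b : R) : (forall i, `|y ord0 i| <= b) ->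
  `|dotp x y| <= b * l1_norm x.
Proof.
move=> yb; rewrite /l1_norm mulr_sumr; apply: le_trans (ler_norm_sum _ _ _) _.
by apply: ler_sum => i _; rewrite normrM mulrC ler_wpM2r.
Qed.

Lemma eucl_ballE (r : R) x : 0 < r -> eucl_ball r x = (dotp x x < r ^+ 2).
Proof.
move=> r0; rewrite /eucl_ball /= /eucl_norm; congr is_true.
by rewrite -[in LHS](ger0_norm (ltW r0)) -sqrtr_sqr ltr_sqrt// exprn_gt0.
Qed.

Lemma eucl_ball_coord (r : R) x i : eucl_ball r x -> `|x ord0 i| < r.
Proof.
rewrite /eucl_ball /= => xr; apply: le_lt_trans xr.
rewrite /eucl_norm -sqrtr_sqr ler_wsqrtr// /dotp (bigD1 i)//= -expr2 lerDl.
by apply: sumr_ge0 => j _; exact: sqr_ge0.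
Qed.

Lemma eucl_ball0 (r : R) : 0 < r -> eucl_ball r (0 : 'rV[R]_d).
Proof. by move=> r0; rewrite eucl_ballE// dotp0l exprn_gt0. Qed.

Lemma eucl_ball_le (r s : R) x : r <= s -> eucl_ball r x -> eucl_ball s x.
Proof. by move=> rs; rewrite /eucl_ball/= => /lt_le_trans; apply. Qed.

Lemma measurable_coord i : measurable_fun setT (fun x : 'rV[R]_d => x ord0 i).
Proof.
apply: (measurability _ (RGenOpens.measurableE R)) => _ [_ [a [b ->]] <-].
rewrite setTI; apply: sub_sigma_algebra => /=.
by apply: open_comp => [x _|]; [exact: coord_continuous|exact: interval_open].
Qed.

Lemma lower_semicontinuous_rV_measurable (f : 'rV[R]_d -> \bar R) :
  lower_semicontinuous f -> measurable_fun setT f.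
Proof.
move=> scif; apply: (measurability _ (ErealGenOInfty.measurableE R)).
move=> /= _ [_ [a ->]] <-; rewrite setTI; apply: sub_sigma_algebra => /=.
by rewrite preimage_itvoy; move/lower_semicontinuousP : scif; exact.
Qed.

Lemma dotp_continuous y : continuous (fun x : 'rV[R]_d => dotp x y).
Proof.
rewrite /dotp; elim: (index_enum _) => [|i r IH].
  rewrite (_ : (fun=> _) = cst 0); first exact: cst_continuous.
  by apply/funext => x; rewrite big_nil.
rewrite (_ : (fun=> _) = (fun x : 'rV[R]_d => x ord0 i * y ord0 i) \+
    (fun x => \sum_(j <- r) x ord0 j * y ord0 j)); last first.
  by apply/funext => x; rewrite big_cons.
move=> x; apply: continuousD; last exact: IH.
by apply: continuousM; [exact: coord_continuous|exact: cst_continuous].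
Qed.

Lemma measurable_dotp dd (T : measurableType dd) (f g : T -> 'rV[R]_d) :
  measurable_fun setT f -> measurable_fun setT g ->
  measurable_fun setT (fun t => dotp (f t) (g t)).
Proof.
move=> mf mg; apply: measurable_sum => i; apply: measurable_funM.
  exact: (measurableT_comp (measurable_coord i) mf).
exact: (measurableT_comp (measurable_coord i) mg).
Qed.

Lemma measurable_eucl_dist_sqr dd (T : measurableType dd) (f g : T -> 'rV[R]_d) :
  measurable_fun setT f -> measurable_fun setT g ->
  measurable_fun setT (fun t => eucl_dist (f t) (g t) ^+ 2).
Proof.
move=> mf mg.
rewrite (_ : (fun t => _) = fun t => dotp (f t) (f t) + dotp (g t) (g t) -
    2 * dotp (f t) (g t)); last by apply/funext => t; exact: eucl_dist_sqrE.
apply: measurable_funB; last by apply: measurable_funM => //; exact: measurable_dotp.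
by apply: measurable_funD; exact: measurable_dotp.
Qed.

Lemma measurable_eucl_ball (r : R) : 0 < r -> measurable (@eucl_ball R d r).
Proof.
move=> r0; rewrite (_ : eucl_ball r = setT `&` (fun x => dotp x x) @^-1` `]-oo, r ^+ 2[).
  by apply: measurable_dotp => //; exact: measurable_id.
by rewrite setTI; apply/funext => x; rewrite eucl_ballE//= in_itv.
Qed.

End row_vectors.

(** * Grids of half-open cubes *)

Section cells.
Context (R : realType) (d : nat).
Implicit Types (x y : 'rV[R]_d) (a : R) (n : nat).

(** The n^d cubes of side 2a/n that tile the box [-a, a)^d, indexed by the position
    of their lowest corner. *)
Definition corner a n (k : {ffun 'I_d -> 'I_n}) : 'rV[R]_d :=
  \row_i (- a + (k i)%:R * (2 * a / n%:R)).

Definition cell a n (k : {ffun 'I_d -> 'I_n}) : set 'rV[R]_d :=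
  [set x | forall i, corner a k ord0 i <= x ord0 i <
                     corner a k ord0 i + 2 * a / n%:R].

Lemma cell_cover a n x : 0 < a -> (0 < n)%N -> (forall i, `|x ord0 i| < a) ->
  exists k : {ffun 'I_d -> 'I_n}, cell a k x.
Proof.
move=> a0 n0 xa; have nR0 : 0 < n%:R :> R by rewrite ltr0n.
pose t i := (x ord0 i + a) / (2 * a / n%:R).
have w0 : 0 < 2 * a / n%:R by rewrite divr_gt0// mulr_gt0.
have t0 i : 0 <= t i.
  by apply: divr_ge0 (ltW w0); have := xa i; rewrite ltr_norml => /andP[]; lra.
have tn i : (Num.truncn (t i) < n)%N.
  rewrite truncn_lt_nat// /t ltr_pdivrMr// mulrC divfK ?gt_eqF//.
  by have := xa i; rewrite ltr_norml => /andP[]; lra.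
exists [ffun i => Ordinal (tn i)] => i; rewrite !mxE !ffunE /=.
have /andP[] := truncn_itv (t0 i).
rewrite {2}/t ler_pdivlMr// => h1; rewrite {1}/t ltr_pdivrMr// -natr1 => h2.
by apply/andP; split; [lra|rewrite mulrDl mul1r in h2; lra].
Qed.

Lemma cell_inj a n (k l : {ffun 'I_d -> 'I_n}) x :
  0 < a -> (0 < n)%N -> cell a k x -> cell a l x -> k = l.
Proof.
move=> a0 n0 kx lx; apply/ffunP => i; apply/val_inj.
have w0 : 0 < 2 * a / n%:R by rewrite divr_gt0// ?mulr_gt0 ?ltr0n.
have H (k' : {ffun 'I_d -> 'I_n}) : cell a k' x ->
    Num.truncn ((x ord0 i + a) / (2 * a / n%:R)) = k' i :> nat.
  move=> /(_ i); rewrite mxE => /andP[h1 h2]; apply: truncn_def.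
  by rewrite ler_pdivlMr// ltr_pdivrMr// -natr1 mulrDl mul1r; apply/andP; split; lra.
by rewrite /= -(H k kx) -(H l lx).
Qed.

Lemma cell_diam a n (k : {ffun 'I_d -> 'I_n}) x y i :
  cell a k x -> cell a k y -> `|x ord0 i - y ord0 i| <= 2 * a / n%:R.
Proof.
by move=> /(_ i)/andP[? ?] /(_ i)/andP[? ?]; rewrite ler_norml; apply/andP; split; lra.
Qed.

Lemma corner_cell a n (k : {ffun 'I_d -> 'I_n}) : 0 < a -> (0 < n)%N ->
  cell a k (corner a k).
Proof.
by move=> a0 n0 i; rewrite lexx ltrDl divr_gt0// ?mulr_gt0 ?ltr0n.
Qed.

Lemma cell_bound a n (k : {ffun 'I_d -> 'I_n}) x i : 0 < a ->
  cell a k x -> `|x ord0 i| <= a.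
Proof.
move=> a0 /(_ i); rewrite mxE => /andP[h1 h2].
have n0 : (0 < n)%N by case: n k h1 h2 => // k; case: (k i).
have nR0 : 0 < n%:R :> R by rewrite ltr0n.
have w0 : 0 < 2 * a / n%:R by rewrite divr_gt0// mulr_gt0.
have k0 : 0 <= (k i)%:R * (2 * a / n%:R) by rewrite mulr_ge0// ltW.
have : ((k i)%:R + 1) * (2 * a / n%:R) <= n%:R * (2 * a / n%:R).
  by rewrite ler_pM2r// natr1 ler_nat.
rewrite [leRHS]mulrC divfK ?gt_eqF// mulrDl mul1r => h3.
by rewrite ler_norml; apply/andP; split; lra.
Qed.

Lemma measurable_cell a n (k : {ffun 'I_d -> 'I_n}) : measurable (cell a k).
Proof.
rewrite (_ : cell a k = \bigcap_(i in [set: 'I_d])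
    ((fun x : 'rV[R]_d => x ord0 i) @^-1`
       `[corner a k ord0 i, corner a k ord0 i + 2 * a / n%:R[)); last first.
  apply/seteqP; split => x h i; first by move=> _; rewrite /= in_itv; exact: h.
  by have := h i Logic.I; rewrite /= in_itv.
apply: fin_bigcap_measurable => // i _; rewrite -[X in measurable X]setTI.
exact: measurable_coord.
Qed.

End cells.

(** * Cyclical monotonicity of optimal couplings *)

Lemma ler_lim_harmonic (R : realType) (A B K : R) :
  (forall n : nat, A <= B + K / n.+1%:R) -> A <= B.
Proof.
move=> h; rewrite leNgt; apply/negP => BA.
have := h (Num.truncn (K / (A - B))); rewrite leNgt => /negP; apply.
have AB : 0 < A - B by rewrite subr_gt0.
rewrite -ltrBrDl ltr_pdivrMr ?ltr0n// mulrC -ltr_pdivrMr//.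
exact: truncnS_gt.
Qed.

Lemma concentrated_coupling d1 d2 (T1 : measurableType d1)
    (T2 : measurableType d2) (R : realType) (alpha : probability T1 R)
    (beta : probability T2 R) (g : probability (T1 * T2)%type R) A B :
  measurable A -> measurable B -> concentrated_on alpha A ->
  concentrated_on beta B -> coupling alpha beta g ->
  g (~` (A `*` B)) = 0%E.
Proof.
move=> mA mB Aa Bb [gA gB].
have -> : ~` (A `*` B) = (fst @^-1` (~` A)) `|` (snd @^-1` (~` B)).
  by apply/seteqP; split => -[a b] /=; [move/not_andP|move=> [h []|h []]].
have mA' : measurable (fst @^-1` (~` A) : set (T1 * T2)).
  by rewrite -[X in measurable X]setTI; apply: measurable_fst => //; exact: measurableC.
have mB' : measurable (snd @^-1` (~` B) : set (T1 * T2)).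
  by rewrite -[X in measurable X]setTI; apply: measurable_snd => //; exact: measurableC.
apply: null_set_setU => //.
  exact: etrans (gA _ (measurableC mA)) Aa.
exact: etrans (gB _ (measurableC mB)) Bb.
Qed.

Section cyclical_monotonicity.
Context (R : realType) (d : nat).
Local Notation V := ('rV[R]_d).
Implicit Types (x y : V) (z : V * V).

Lemma half_sqr_dist_close (a b r s : R) x y x' y' :
  (forall i, `|x ord0 i| <= a) -> (forall i, `|x' ord0 i| <= a) ->
  (forall i, `|y ord0 i| <= b) -> (forall i, `|y' ord0 i| <= b) ->
  (forall i, `|x ord0 i - x' ord0 i| <= r) ->
  (forall i, `|y ord0 i - y' ord0 i| <= s) ->
  `|2^-1 * eucl_dist x y ^+ 2 - 2^-1 * eucl_dist x' y' ^+ 2| <=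
    d%:R * ((r + s) * (a + b)).
Proof.
move=> xa xa' yb yb' xr ys.
rewrite -mulrBr !eucl_dist_sqr -sumrB mulr_sumr.
apply: le_trans (ler_norm_sum _ _ _) _.
rewrite [leRHS](_ : _ = \sum_(i < d) ((r + s) * (a + b))); last first.
  by rewrite sumr_const card_ord mulr_natl.
apply: ler_sum => i _; rewrite subr_sqr mulrCA normrM.
have h1 : `|x ord0 i - y ord0 i - (x' ord0 i - y' ord0 i)| <= r + s.
  rewrite (_ : _ - _ = (x ord0 i - x' ord0 i) - (y ord0 i - y' ord0 i)); last by ring.
  by apply: le_trans (ler_normB _ _) _; apply: lerD.
have h2 : `|2^-1 * (x ord0 i - y ord0 i + (x' ord0 i - y' ord0 i))| <= a + b.
  move: (xa i) (xa' i) (yb i) (yb' i); rewrite !ler_norml.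
  move=> /andP[? ?] /andP[? ?] /andP[? ?] /andP[? ?].
  by apply/andP; split; lra.
by apply: ler_pM.
Qed.

(** The exceptional set collects, over all n, the products of grid cubes of mass
    zero.  A point outside it lies at every scale in a product of positive mass,
    on which the cost oscillates by O(1/n); the perturbation inequality for these
    products becomes cyclical monotonicity when n tends to infinity. *)
Lemma optimal_coupling_cyclically_monotone (alpha beta : probability V R)
    (g : probability (V * V)%type R) (a b : R) :
  0 < a -> 0 < b -> concentrated_on alpha (eucl_ball a) ->
  concentrated_on beta (eucl_ball b) -> optimal_coupling alpha beta g ->
  exists S : set (V * V), [/\ measurable S, g (~` S) = 0%E,
    (forall z, S z -> eucl_ball a z.1 /\ eucl_ball b z.2) &
    forall N (z : nat -> V * V), (forall i, S (z i)) -> z N = z 0%N ->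
      \sum_(i < N) dotp (z i.+1).1 (z i).2 <= \sum_(i < N) dotp (z i).1 (z i).2].
Proof.
move=> a0 b0 ca cb [gc gopt].
pose E : set (V * V) := eucl_ball a `*` eucl_ball b.
have ma : measurable (@eucl_ball R d a) by exact: measurable_eucl_ball.
have mb : measurable (@eucl_ball R d b) by exact: measurable_eucl_ball.
have mE : measurable E by exact: measurableX.
have gE : g (~` E) = 0%E by exact: concentrated_coupling gc.
pose Q n (p : {ffun 'I_d -> 'I_n.+1} * {ffun 'I_d -> 'I_n.+1}) : set (V * V) :=
  cell a p.1 `*` cell b p.2.
have mQ n p : measurable (Q n p) by apply: measurableX; exact: measurable_cell.
pose bad n p : set (V * V) := if g (Q n p) == 0%E then Q n p else set0.
have mbad n p : measurable (bad n p) by rewrite /bad; case: ifP.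
have gbad n p : g (bad n p) = 0%E.
  by rewrite /bad; case: ifP => [/eqP//|_]; rewrite measure0.
pose B := \bigcup_n \big[setU/set0]_(p <- index_enum _) bad n p.
have mB : measurable B.
  apply: bigcupT_measurable => n.
  elim: (index_enum _) => [|p s IH]; first by rewrite big_nil; exact: measurable0.
  by rewrite big_cons; exact: measurableU.
have gB : g B = 0%E.
  apply/(negligibleP _ mB); apply: negligible_bigcup => n.
  elim: (index_enum _) => [|p s IH]; first by rewrite big_nil; exact: negligible_set0.
  rewrite big_cons; apply: negligibleU; last exact: IH.
  by apply/(negligibleP _ (mbad n p)); exact: gbad.
exists (E `\` B); split.
- exact: measurableD.
- by rewrite setCD; apply: null_set_setU => //; exact: measurableC.
- by move=> z [].
move=> N z Sz zN.
have [->|N0] := posnP N; first by rewrite !big_ord0.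
pose c (p : V * V) := 2^-1 * eucl_dist p.1 p.2 ^+ 2.
have mc : measurable_fun setT c.
  apply: measurable_funM => //; apply: measurable_eucl_dist_sqr.
    exact: measurable_fst.
  exact: measurable_snd.
have c0 p : 0 <= c p by rewrite /c mulr_ge0// ?invr_ge0// sqr_ge0.
have ccyc : \sum_(i < N) c (z i) <= \sum_(i < N) c ((z i.+1).1, (z i).2).
  pose K := N%:R * (2 * (d%:R * (2 * (a + b) * (a + b)))).
  apply: (ler_lim_harmonic (K := K)) => n.
  pose eta := d%:R * ((2 * a / n.+1%:R + 2 * b / n.+1%:R) * (a + b)).
  have -> : K / n.+1%:R = N%:R * (2 * eta).
    have : n.+1%:R != 0 :> R by rewrite pnatr_eq0.
    by rewrite /K /eta; move: (n.+1%:R) => m m0; field.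
  have eta0 : 0 <= eta.
    by rewrite /eta !mulr_ge0// addr_ge0// ?mulr_ge0 ?divr_ge0 ?mulr_ge0 ?ltW.
  have hp p : E p -> exists q, Q n q p.
    move=> [/= p1 p2].
    have [k kp] := @cell_cover R d a n.+1 p.1 a0 isT (fun i => eucl_ball_coord i p1).
    have [l lp] := @cell_cover R d b n.+1 p.2 b0 isT (fun i => eucl_ball_coord i p2).
    by exists (k, l).
  pose q i := projT1 (cid (hp (z i) (Sz i).1)).
  have Qq i : Q n (q i) (z i) by exact: (projT2 (cid (hp (z i) (Sz i).1))).
  (* The cells are picked by choice, yet equal points get equal cells. *)
  have qN : q N = q 0%N.
    rewrite /q; move: (Sz N).1 (Sz 0%N).1; rewrite zN => e1 e2.
    by rewrite (Prop_irrelevance e1 e2).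
  have gQ i : (0 < g (Q n (q i)))%E.
    rewrite lt0e measure_ge0 andbT; apply/negP => g0.
    apply: (Sz i).2; exists n => //; rewrite -bigcup_seq/=; exists (q i).
      by rewrite /= mem_index_enum.
    by rewrite /bad g0.
  have cQ i p1 p2 j p1' p2' : cell a (q i).1 p1 -> cell a (q i).1 p1' ->
      cell b (q j).2 p2 -> cell b (q j).2 p2' ->
      `|c (p1, p2) - c (p1', p2')| <= eta.
    move=> h1 h1' h2 h2'; apply: half_sqr_dist_close => k.
    - exact: cell_bound h1.
    - exact: cell_bound h1'.
    - exact: cell_bound h2.
    - exact: cell_bound h2'.
    - exact: cell_diam h1 h1'.
    - exact: cell_diam h2 h2'.
  have := @coupling_cyclic_cells _ _ V V R alpha beta g c N (fun i => Q n (q i))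
    (fun i => Num.max 0 (c (z i) - eta)) (fun i => c ((z i.+1).1, (z i).2) + eta)
    gc mc c0.
  have cfin : (\int[g]_z (c z)%:E < +oo)%E.
    apply: (@le_lt_trans _ _ (((d%:R * ((a + b) * (a + b)))%:E) * g setT)%E).
      apply: (le_integral_cst (A := E)) => //.
      - exact/measurable_EFinP.
      - by rewrite lee_fin mulr_ge0// mulr_ge0// addr_ge0// ltW.
      - move=> p [/= p1 p2]; rewrite lee_fin.
        have := @half_sqr_dist_close a b a b p.1 p.2 0 0.
        rewrite {2}/eucl_dist subrr /eucl_norm dotp0l sqrtr0 expr0n mulr0 subr0.
        rewrite ger0_norm ?c0// -/(c p); apply => i; rewrite ?mxE ?subr0 ?normr0 ?ltW//.
        + exact: eucl_ball_coord.
        + exact: eucl_ball_coord.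
        + exact: eucl_ball_coord.
        + exact: eucl_ball_coord.
    by rewrite probability_setT mule1 ltry.
  move=> /(_ cfin gopt N0 (fun i => mQ n (q i)) gQ).
  rewrite qN => /(_ erefl) H.
  have {H} := H _ _ _ _.
  have lo0 i : 0 <= Num.max 0 (c (z i) - eta) by rewrite le_max lexx.
  have up0 i : 0 <= c ((z i.+1).1, (z i).2) + eta by rewrite addr_ge0.
  move=> /(_ lo0 up0) H.
  have : \sum_(i < N) Num.max 0 (c (z i) - eta) <=
         \sum_(i < N) (c ((z i.+1).1, (z i).2) + eta).
    apply: H.
      move=> i p [/= p1 p2]; rewrite ge_max c0/=.
      have := cQ i p.1 p.2 i (z i).1 (z i).2 p1 (Qq i).1 p2 (Qq i).2.
      by rewrite -!surjective_pairing ler_norml => /andP[]; lra.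
    move=> i p p' [/= _ p2] [/= p1 _].
    have := cQ i.+1 p'.1 p.2 i (z i.+1).1 (z i).2 p1 (Qq i.+1).1 p2 (Qq i).2.
    by rewrite ler_norml => /andP[]; lra.
  have h : \sum_(i < N) (c (z i) - eta) <= \sum_(i < N) Num.max 0 (c (z i) - eta).
    by apply: ler_sum => i _; rewrite le_max lexx orbT.
  move=> /(le_trans h); rewrite sumrB big_split /= !sumr_const card_ord -mulr_natl.
  by lra.
(* The squared norms cancel along a cycle, which leaves the inner products. *)
pose sq (i : nat) := 2^-1 * dotp (z i).1 (z i).1.
have cE p : c p = 2^-1 * dotp p.1 p.1 + 2^-1 * dotp p.2 p.2 - dotp p.1 p.2.
  by rewrite /c eucl_dist_sqrE; field.
move: ccyc; under eq_bigr do rewrite cE.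
under [leRHS]eq_bigr do rewrite cE /=.
rewrite !sumrB !big_split/= (sum_cyclic_shift (F := sq)) ?lerD2l ?lerN2//.
by rewrite /sq zN.
Qed.

End cyclical_monotonicity.

(** * Conjugates and lower semicontinuity *)

Section lower_semicontinuity.
Context (R : realType) (d : nat).
Local Notation V := ('rV[R]_d).
Local Open Scope ereal_scope.

Lemma lower_semicontinuous_sup (I : Type) (A : set I) (F : I -> V -> \bar R) :
  (forall i, A i -> lower_semicontinuous (F i)) ->
  lower_semicontinuous (fun x => ereal_sup [set F i x | i in A]).
Proof.
move=> lF x a /ereal_sup_gt [_ [i Ai <-]] /(lF i Ai x a) [U xU aU].
exists U => // y Uy; apply: lt_le_trans (aU y Uy) _.
by apply: ereal_sup_ubound; exists i.
Qed.

Lemma lower_semicontinuous_affine (y : V) (c : R) :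
  lower_semicontinuous (fun x : V => (dotp x y + c)%:E).
Proof.
apply/lower_semicontinuousP => a.
rewrite (_ : [set x | _] = (fun x => dotp x y) @^-1` [set t | (a - c < t)%R]).
  by apply: open_comp; [move=> x _; exact: dotp_continuous|exact: open_gt].
by apply/seteqP; split => x /=; rewrite lte_fin ltrBlDr.
Qed.

Lemma lower_semicontinuous_fenchel_conj (phi : V -> \bar R) :
  lower_semicontinuous (fenchel_conj phi).
Proof.
apply: lower_semicontinuous_sup => x _.
case: (phi x) => [r| |].
- rewrite (_ : (fun y => _) = fun y => (dotp y x + - r)%:E).
    exact: lower_semicontinuous_affine.
  by apply/funext => y; rewrite dotpC EFinD.
- by move=> y a /=; rewrite addeNy.
- apply/lower_semicontinuousP => a; rewrite (_ : [set y | _] = setT).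
    exact: openT.
  by apply/seteqP; split => y //= _; exact: ltry.
Qed.

Lemma measurable_fenchel_conj (phi : V -> \bar R) :
  measurable_fun setT (fenchel_conj phi).
Proof.
apply: lower_semicontinuous_rV_measurable.
exact: lower_semicontinuous_fenchel_conj.
Qed.

Lemma fenchel_conj_ge (phi : V -> \bar R) x y :
  (dotp x y)%:E - phi x <= fenchel_conj phi y.
Proof. by apply: ereal_sup_ubound; exists x. Qed.

(** Properness excludes the sum of opposite infinities. *)
Lemma fenchel_young (phi : V -> \bar R) x y : eproper phi ->
  (dotp x y)%:E <= phi x + fenchel_conj phi y.
Proof.
move=> [phiNy [x0 phix0]].
have := fenchel_conj_ge phi x y; have := fenchel_conj_ge phi x0 y.
have := phiNy x0; have := phiNy x; move: phix0.
case: (phi x0) => // r0 _; case: (phi x) => [r| |] // _ _.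
  by move=> _; rewrite -EFinB; case: (fenchel_conj phi y) => [s| |] //;
     rewrite -?EFinD ?lee_fin ?addey ?leey//; lra.
by case: (fenchel_conj phi y) => [s| |] //; rewrite ?leey.
Qed.

End lower_semicontinuity.

(** * The Rockafellar potential of a cyclically monotone set *)

Section rockafellar.
Context (R : realType) (d : nat).
Local Notation V := ('rV[R]_d).
Implicit Types (x : V) (z w : V * V).

(** The affine minorant at x obtained by following the subgradients attached to the
    points z, s_1, ..., s_n in turn. *)
Fixpoint chain z (s : seq (V * V)) x : R :=
  if s is w :: s' then dotp (w.1 - z.1) z.2 + chain w s' x
  else dotp (x - z.1) z.2.

Lemma chain_affine z s x : chain z s x = dotp x (last z s).2 + chain z s 0.
Proof.
elim: s z => [|w s IH] z /=; last by rewrite IH; ring.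
by rewrite !dotpBl dotp0l; ring.
Qed.

Lemma chain_rcons z s w x :
  chain z (rcons s w) x = chain z s w.1 + dotp (x - w.1) w.2.
Proof. by elim: s z => [|w' s IH] z //=; rewrite IH addrA. Qed.

(** The default value w of [nth] closes the chain into a cycle when w is its first
    point. *)
Lemma chain_sum z s w : chain z s w.1 = \sum_(i < (size s).+1)
  dotp ((nth w (z :: s) i.+1).1 - (nth w (z :: s) i).1) (nth w (z :: s) i).2.
Proof.
elim: s z => [|w' s IH] z /=; first by rewrite big_ord_recl big_ord0 addr0.
by rewrite IH [RHS]big_ord_recl.
Qed.

(** The potential is the supremum of the chains that start at z0 and stay in S.
    Cyclical monotonicity says that it is nonpositive at z0; prolonging a chain by
    one more point z of S gives the subgradient inequality at z.  The two explicit
    affine bounds keep it bounded on S when S is bounded. *)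
Lemma rockafellar_potential (S : set (V * V)) z0 : S z0 ->
  (forall N (z : nat -> V * V), (forall i, S (z i)) -> z N = z 0%N ->
    \sum_(i < N) dotp (z i.+1).1 (z i).2 <= \sum_(i < N) dotp (z i).1 (z i).2) ->
  exists psi : V -> \bar R, [/\ @Gamma0 R d psi,
    forall x, ((dotp (x - z0.1) z0.2)%:E <= psi x)%E,
    forall z, S z -> (psi z.1 <= (dotp (z.1 - z0.1) z.2)%:E)%E &
    forall z, S z -> (psi z.1 + fenchel_conj psi z.2 = (dotp z.1 z.2)%:E)%E].
Proof.
move=> Sz0 cyc.
pose A : set (seq (V * V)) := [set s | forall i, S (nth z0 s i)].
pose psi x := ereal_sup [set (chain z0 s x)%:E | s in A].
have psi_ge s x : A s -> ((chain z0 s x)%:E <= psi x)%E.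
  by move=> As; apply: ereal_sup_ubound; exists s.
have A0 : A [::] by move=> i; rewrite nth_nil.
have psi_ge0 x : ((dotp (x - z0.1) z0.2)%:E <= psi x)%E by exact: (psi_ge [::]).
have psi0 : (psi z0.1 <= 0)%E.
  apply: ge_ereal_sup => _ [s As <-]; rewrite lee_fin chain_sum.
  under eq_bigr do rewrite dotpBl.
  rewrite sumrB subr_le0; apply: (cyc _ (fun i => nth z0 (z0 :: s) i)).
    by case=> [|i] //=; exact: As.
  by rewrite /= nth_default.
have psi_step z x : S z -> (psi z.1 + (dotp (x - z.1) z.2)%:E <= psi x)%E.
  move=> Sz; rewrite -leeBrDr//; apply: ge_ereal_sup => _ [s As <-].
  rewrite leeBrDr// -EFinD -chain_rcons; apply: psi_ge => i.
  by rewrite nth_rcons; case: ifP => _; [exact: As|case: ifP].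
have psiS z : S z -> (psi z.1 <= (dotp (z.1 - z0.1) z.2)%:E)%E.
  move=> Sz; have := le_trans (psi_step z z0.1 Sz) psi0.
  rewrite -leeBrDr// sub0e -EFinN (_ : - dotp _ _ = dotp (z.1 - z0.1) z.2)%R//.
  by rewrite !dotpBl opprB.
have psifin z : S z -> psi z.1 \is a fin_num.
  move=> Sz; have h1 := psiS z Sz; have h2 := psi_ge0 z.1.
  by rewrite fin_numE; apply/andP; split; apply/eqP => h; rewrite h in h1 h2.
have psiNy x : psi x != -oo%E by apply/eqP => h; have := psi_ge0 x; rewrite h.
have pr : eproper psi.
  by split=> //; exists z0.1; apply/eqP => h; rewrite h in psi0.
exists psi; split => //.
  split => //.
    apply: lower_semicontinuous_sup => s _.
    rewrite (_ : (fun x => _) = fun x => (dotp x (last z0 s).2 + chain z0 s 0)%:E).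
      exact: lower_semicontinuous_affine.
    by apply/funext => x; rewrite chain_affine.
  move=> x y t /andP[t0 t1]; apply: ge_ereal_sup => _ [s As <-].
  rewrite (_ : chain z0 s _ = t * chain z0 s x + (1 - t) * chain z0 s y).
    rewrite EFinD !EFinM; apply: leeD; apply: lee_wpmul2l;
      rewrite ?lee_fin ?subr_ge0//; exact: psi_ge.
  by rewrite chain_affine (chain_affine _ _ x) (chain_affine _ _ y) dotpDl !dotpZl; ring.
move=> z Sz; apply/eqP; rewrite eq_le fenchel_young// andbT.
rewrite -leeBrDl ?psifin//; apply: ge_ereal_sup => _ [x _ <-].
have := psi_step z x Sz; have := psiNy x; move: (psifin z Sz).
case: (psi z.1) => [r| |] //; case: (psi x) => [s| |] // _ _; last first.
  by move=> _; rewrite addeNy leNye.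
rewrite -EFinD -!EFinB !lee_fin dotpBl; lra.
Qed.

End rockafellar.

(** * Optimal potentials and optimal couplings *)

Section kantorovich.
Local Open Scope ereal_scope.

Lemma integral_marginals d1 d2 (T1 : measurableType d1) (T2 : measurableType d2)
    (R : realType) (alpha : probability T1 R) (beta : probability T2 R)
    (g : probability (T1 * T2)%type R) (u : T1 -> \bar R) (v : T2 -> \bar R)
    (D : set (T1 * T2)) (K : R) :
  coupling alpha beta g -> measurable_fun setT u -> measurable_fun setT v ->
  measurable D -> g (~` D) = 0 ->
  (forall z, D z -> `|u z.1| <= K%:E) -> (forall z, D z -> `|v z.2| <= K%:E) ->
  [/\ g.-integrable setT (u \o fst), g.-integrable setT (v \o snd) &
   \int[alpha]_x u x + \int[beta]_y v y = \int[g]_z (u z.1 + v z.2)].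
Proof.
move=> [gA gB] mu mv mD gD uK vK.
have int (w : T1 * T2 -> \bar R) : measurable_fun setT w ->
    (forall z, D z -> `|w z| <= K%:E) -> g.-integrable setT w.
  move=> mw wK; apply/integrableP; split => //.
  apply: (@le_lt_trans _ _ (`|K|%:E * g setT)).
    apply: (le_integral_cst (A := D)) => //; first exact: measurableT_comp.
    by move=> z /wK/le_trans; apply; rewrite lee_fin ler_norm.
  by rewrite probability_setT mule1 ltry.
have iu : g.-integrable setT (u \o fst).
  by apply: int => //; exact: measurableT_comp.
have iv : g.-integrable setT (v \o snd).
  by apply: int => //; exact: measurableT_comp.
split => //; rewrite (@integralD _ _ _ g setT measurableT (u \o fst) (v \o snd))//.
congr (_ + _).
- rewrite -[RHS](_ : \int[push_measure g measurable_fst]_x u x = _).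
    by apply: eq_measure_integral => A mA _; exact: esym (gA _ mA).
  exact: (integral_pushforward measurable_fst mu iu measurableT).
- rewrite -[RHS](_ : \int[push_measure g measurable_snd]_x v x = _).
    by apply: eq_measure_integral => A mA _; exact: esym (gB _ mA).
  exact: (integral_pushforward measurable_snd mv iv measurableT).
Qed.

Context (R : realType) (d : nat).
Local Notation V := ('rV[R]_d).

Lemma lipschitz_real_on_bounded (k r : R) (u : V -> \bar R) : (0 < r)%R ->
  lipschitz_real_on k (eucl_ball r) u ->
  exists K : R, forall x, eucl_ball r x -> `|u x| <= K%:E.
Proof.
move=> r0 [ufin ulip]; exists (`|fine (u 0%R)| + `|k| * r)%R => x xr.
have h0 := eucl_ball0 d r0.
have := ulip x 0%R xr h0; move: (ufin x xr) (ufin 0%R h0).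
case: (u x) => // s _; case: (u 0%R) => // t _ /=.
rewrite !lee_fin => st.
have -> : s = (t + (s - t))%R by ring.
apply: le_trans (ler_normD _ _) _; rewrite lerD2l; apply: le_trans st _.
apply: le_trans (ler_norm _) _; rewrite normrM ler_wpM2l//.
by rewrite ger0_norm ?sqrtr_ge0// /eucl_dist subr0; exact: ltW.
Qed.

Definition duality_gap (phi : V -> \bar R) (z : V * V) : \bar R :=
  phi z.1 + fenchel_conj phi z.2 - (dotp z.1 z.2)%:E.

Lemma duality_gap_ge0 phi z : eproper phi -> 0 <= duality_gap phi z.
Proof. by move=> phip; rewrite sube_ge0//; exact: fenchel_young. Qed.

Lemma measurable_duality_gap phi : lower_semicontinuous phi ->
  measurable_fun setT (duality_gap phi).
Proof.
move=> lphi; apply: emeasurable_funB.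
  apply: emeasurable_funD.
    apply: (measurableT_comp _ measurable_fst).
    exact: lower_semicontinuous_rV_measurable.
  by apply: (measurableT_comp _ measurable_snd); exact: measurable_fenchel_conj.
apply/measurable_EFinP.
by apply: measurable_dotp; [exact: measurable_fst|exact: measurable_snd].
Qed.

(** The Rockafellar potential psi of the cyclically monotone set S that carries g
    satisfies psi + psi^* = <., .> on S, so that its dual value is \int <x, y> dg.
    By optimality the dual value of phi is not larger, hence the nonnegative gap of
    phi has an integral at most 0. *)
Lemma optimal_potential_complementary (alpha beta : probability V R)
    (g : probability (V * V)%type R) (a b : R) (phi : V -> \bar R) :
  (0 < a)%R -> (0 < b)%R -> concentrated_on alpha (eucl_ball a) ->
  concentrated_on beta (eucl_ball b) -> optimal_coupling alpha beta g ->
  lipschitz_class (4 * a) (4 * b) phi ->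
  optimal_brenier_potential alpha beta phi ->
  exists S : set (V * V), [/\ measurable S, g (~` S) = 0,
    forall z, S z -> eucl_ball a z.1 /\ eucl_ball b z.2 &
    forall z, S z -> phi z.1 + fenchel_conj phi z.2 = (dotp z.1 z.2)%:E].
Proof.
move=> a0 b0 ca cb go [[phip phil phic] phiL phiL'] [_ phiopt].
have [S [mS gS Sab Scyc]] := optimal_coupling_cyclically_monotone a0 b0 ca cb go.
have [z0 Sz0] : S !=set0.
  apply/set0P/eqP => S0; move: gS; rewrite S0 setC0 probability_setT => /eqP.
  by rewrite onee_eq0.
have [psi [psiG psi_ge psi_le psiE]] := rockafellar_potential Sz0 Scyc.
have a4 : (a <= 4 * a)%R by lra.
have b4 : (b <= 4 * b)%R by lra.
have [K1 phiK1] := lipschitz_real_on_bounded (lt_le_trans a0 a4) phiL.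
have [K2 phiK2] := lipschitz_real_on_bounded (lt_le_trans b0 b4) phiL'.
have [K3 dotpK] : exists K3 : R, forall x y x' : V, eucl_ball a x ->
    eucl_ball a x' -> eucl_ball b y -> (`|dotp (x - x') y| <= K3)%R.
  exists (b * (d%:R * (2 * a)))%R => x y x' xa xa' yb.
  apply: le_trans (ler_dotp_l1 _ (fun i => ltW (eucl_ball_coord i yb))) _.
  rewrite ler_pM2l// /l1_norm.
  apply: (@le_trans _ _ (\sum_(i < d) (2 * a))%R); last first.
    by rewrite sumr_const card_ord -[leLHS]mulr_natl.
  apply: ler_sum => i _; rewrite !mxE.
  have := eucl_ball_coord i xa; have := eucl_ball_coord i xa'.
  rewrite !ltr_norml ler_norml => /andP[? ?] /andP[? ?].
  by apply/andP; split; lra.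
have dotpK0 z : S z -> (`|dotp z.1 z.2| <= K3)%R.
  move=> /Sab[z1 z2]; rewrite -[z.1]subr0; apply: dotpK => //.
  exact: eucl_ball0.
have psiK z : S z -> `|psi z.1| <= K3%:E.
  move=> Sz; have [z1 z2] := Sab z Sz; have [z01 z02] := Sab z0 Sz0.
  have := dotpK _ _ _ z1 z01 z2; have := dotpK _ _ _ z1 z01 z02.
  move: (psi_ge z.1) (psi_le z Sz); case: (psi z.1) => [r| |]//.
  rewrite /abse !lee_fin !ler_norml => h1 h2 /andP[h3 h4] /andP[h5 h6].
  by apply/andP; split; lra.
have psiK' z : S z -> `|fenchel_conj psi z.2| <= (2 * K3)%:E.
  move=> Sz; move: (psiK z Sz) (psiE z Sz) (dotpK0 z Sz).
  case: (psi z.1) => [r| |] //; case: (fenchel_conj psi z.2) => [s| |] //.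
  rewrite /abse !lee_fin !ler_norml => /andP[h1 h2] [h3] /andP[h4 h5].
  by apply/andP; split; lra.
pose K := (Num.max (Num.max `|K1| `|K2|) (2 * `|K3|))%R.
have K1K : (K1 <= K)%R by rewrite !le_max ler_norm.
have K2K : (K2 <= K)%R by rewrite !le_max ler_norm orbT.
have K3K : (2 * K3 <= K)%R by rewrite !le_max ler_pM2l// ler_norm orbT.
have K3K' : (K3 <= K)%R.
  have := ler_norm K3; have := normr_ge0 K3.
  by rewrite !le_max => ? ?; apply/orP; right; lra.
have mphi : measurable_fun setT phi by exact: lower_semicontinuous_rV_measurable.
have mpsi : measurable_fun setT psi.
  by apply: lower_semicontinuous_rV_measurable; case: psiG.
have [iphi iphi' phiI] := integral_marginals go.1 mphi
  (@measurable_fenchel_conj _ _ phi) mS gS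
  (fun z Sz => le_trans (phiK1 _ (eucl_ball_le a4 (Sab z Sz).1)) (K1K : K1%:E <= K%:E))
  (fun z Sz => le_trans (phiK2 _ (eucl_ball_le b4 (Sab z Sz).2)) (K2K : K2%:E <= K%:E)).
have [_ _ psiI] := integral_marginals go.1 mpsi
  (@measurable_fenchel_conj _ _ psi) mS gS
  (fun z Sz => le_trans (psiK z Sz) (K3K' : K3%:E <= K%:E))
  (fun z Sz => le_trans (psiK' z Sz) (K3K : (2 * K3)%:E <= K%:E)).
have mdot : measurable_fun setT (fun z : V * V => (dotp z.1 z.2)%:E).
  apply/measurable_EFinP.
  by apply: measurable_dotp; [exact: measurable_fst|exact: measurable_snd].
have idot : g.-integrable setT (fun z : V * V => (dotp z.1 z.2)%:E).
  apply/integrableP; split => //.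
  apply: (@le_lt_trans _ _ (`|K3|%:E * g setT)).
    apply: (le_integral_cst (A := S)) => //; first exact: measurableT_comp.
    by move=> z /dotpK0 h; rewrite /= lee_fin (le_trans h)// ler_norm.
  by rewrite probability_setT mule1 ltry.
have le_phi : \int[g]_z (phi z.1 + fenchel_conj phi z.2) <= \int[g]_z (dotp z.1 z.2)%:E.
  rewrite -phiI -[leLHS]/(brenier_functional alpha beta phi) phiopt.
  apply: (@le_trans _ _ (brenier_functional alpha beta psi)).
    by apply: ereal_inf_lbound; exists psi.
  rewrite /brenier_functional psiI le_eqVlt; apply/orP; left; apply/eqP.
  apply: ae_eq_integral => //.
    apply: emeasurable_funD.
      exact: (measurableT_comp mpsi measurable_fst).
    by apply: (measurableT_comp _ measurable_snd); exact: measurable_fenchel_conj.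
  exists (~` S); split => //; first exact: measurableC.
  by move=> z /= h Sz; apply: h => _; exact: psiE.
have gap0 : \int[g]_z `|duality_gap phi z| = 0.
  under eq_integral do rewrite gee0_abs ?duality_gap_ge0//.
  apply/eqP; rewrite eq_le; apply/andP; split; last first.
    by apply: integral_ge0 => z _; exact: duality_gap_ge0.
  rewrite (@integralB _ _ _ g setT measurableT
    (fun z : V * V => phi z.1 + fenchel_conj phi z.2) (fun z : V * V => (dotp z.1 z.2)%:E))//.
    rewrite sube_le0//.
  exact: (integrableD measurableT iphi iphi').
have mgap := measurable_duality_gap phil.
have [N [mN gN gapN]] := (ae_eq_integral_abs g measurableT mgap).1 gap0.
exists (S `\` N); split.
- exact: measurableD.
- by rewrite setCD; apply: null_set_setU => //; exact: measurableC.
- by move=> z [/Sab].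
move=> z [Sz Nz].
have gz : duality_gap phi z = 0.
  by apply: contrapT => h; apply: Nz; apply: gapN => /= h'; apply: h; exact: h'.
apply/eqP; rewrite eq_le fenchel_young// andbT.
by rewrite -sube_le0// -/(duality_gap phi z) gz.
Qed.

End kantorovich.

(** * The integral of second differences *)

Section second_difference.
Context (R : realType) (d : nat).
Local Notation V := ('rV[R]_d).
Implicit Types (x y h : V) (f : V -> R).

Definition l1_lipschitz (L : R) f := forall x y, `|f x - f y| <= L * l1_norm (x - y).

Definition second_diff f h x : R := f (x + h) + f (x - h) - 2 * f x.

Lemma l1_norm_shift (t : R) i : l1_norm (t *: delta_mx ord0 i : V) = `|t|.
Proof.
rewrite /l1_norm (bigD1 i)//= !mxE !eqxx mulr1 big1 ?addr0// => j ji.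
by rewrite !mxE (negPf ji) andbF mulr0 normr0.
Qed.

Lemma l1_lipschitz_measurable (L : R) f : l1_lipschitz L f -> measurable_fun setT f.
Proof.
move=> fL; apply/measurable_EFinP; apply: lower_semicontinuous_rV_measurable.
move=> x a; rewrite lte_fin => afx.
have L0 : 0 < `|L| * d%:R + 1 by rewrite ltr_wpDl// mulr_ge0.
pose e := (f x - a) / (`|L| * d%:R + 1).
have e0 : 0 < e by rewrite divr_gt0// subr_gt0.
exists (ball x e); first by apply: nbhsx_ballx.
move=> y [_ xy]; rewrite lte_fin.
have : `|f x - f y| < f x - a.
  apply: le_lt_trans (fL x y) _.
  apply: (@le_lt_trans _ _ ((`|L| * d%:R) * e)).
    apply: (@le_trans _ _ (`|L| * l1_norm (x - y))).
      by rewrite ler_wpM2r ?l1_norm_ge0// ler_norm.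
    rewrite -mulrA ler_wpM2l// /l1_norm.
    apply: (@le_trans _ _ (\sum_(i < d) e)); last first.
      by rewrite sumr_const card_ord -[leLHS]mulr_natl.
    by apply: ler_sum => i _; rewrite !mxE; apply: ltW; exact: xy.
  rewrite /e mulrCA -[ltRHS]mulr1 ltr_pM2l ?subr_gt0// ltr_pdivrMr// mul1r.
  by rewrite ltrDl.
by rewrite ltr_norml => /andP[]; lra.
Qed.

Lemma second_diff_lipschitz (L : R) f h : l1_lipschitz L f ->
  l1_lipschitz (4 * L) (second_diff f h).
Proof.
move=> fL x y; have := fL x y; have := fL (x + h) (y + h); have := fL (x - h) (y - h).
rewrite (_ : x - h - (y - h) = x - y); last by rewrite opprB addrA subrK.
rewrite (_ : x + h - (y + h) = x - y); last by rewrite opprD addrACA subrr addr0.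
rewrite /second_diff !ler_norml => /andP[? ?] /andP[? ?] /andP[? ?].
by apply/andP; split; lra.
Qed.

(** Averages a function of grid points over the grid lines parallel to one axis: the
    exchange of k i with j is an involution of the pairs (k, j). *)
Lemma sum_ffun_update n (i : 'I_d) (F : {ffun 'I_d -> 'I_n} -> R) :
  n%:R * \sum_k F k =
  \sum_(k : {ffun 'I_d -> 'I_n}) \sum_(j < n) F [ffun l => if l == i then j else k l].
Proof.
rewrite (_ : n%:R * _ = \sum_k \sum_(j < n) F k); last first.
  rewrite mulr_sumr; apply: eq_bigr => k _.
  by rewrite sumr_const card_ord mulr_natl.
rewrite !pair_big /=.
pose s (p : {ffun 'I_d -> 'I_n} * 'I_n) : {ffun 'I_d -> 'I_n} * 'I_n :=
  ([ffun l => if l == i then p.2 else p.1 l], p.1 i).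
rewrite (reindex_inj (inv_inj (_ : involutive s))) //.
move=> [k j]; rewrite /s /= ffunE eqxx; congr pair.
by apply/ffunP => l; rewrite !ffunE; case: eqP => [->|].
Qed.

(** Increments of step N are sums of N increments of step 1, whose sums over j
    telescope; hence a bound independent of n. *)
Lemma sum_shift_le (A : nat -> R) (B : R) n N : (forall j, `|A j| <= B) ->
  \sum_(j < n) (A (j + N)%N - A j) <= N%:R * (2 * B).
Proof.
move=> AB; elim: N => [|N IH].
  by rewrite mul0r big1// => j _; rewrite addn0 subrr.
rewrite (eq_bigr (fun j : 'I_n => (A (j.+1 + N)%N - A (j + N)%N) +
    (A (j + N)%N - A j))); last by move=> j _; rewrite addnS addSn; ring.
rewrite big_split /= -natr1 mulrDl mul1r addrC lerD//.
rewrite -(big_mkord xpredT (fun j => A (j.+1 + N)%N - A (j + N)%N)).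
rewrite (telescope_sumr (fun j => A (j + N)%N))//.
by have := AB (n + N)%N; have := AB (0 + N)%N; rewrite !ler_norml => /andP[? ?] /andP[? ?]; lra.
Qed.

(** With N^2 cells per axis, a step r is exactly N cells, and the second difference is
    an increment of step N of the first difference A along a grid line. *)
Lemma sum_second_diff_cells (L a r : R) N (i : 'I_d) f : 0 < a -> (0 < N)%N ->
  l1_lipschitz L f ->
  r = 2 * a / N%:R ->
  (N ^ 2)%:R * \sum_(k : {ffun 'I_d -> 'I_(N ^ 2)})
     second_diff f (r *: delta_mx ord0 i) (corner a k) <=
  ((N ^ 2) ^ d)%:R * (N%:R * (2 * (L * r))).
Proof.
move=> a0 N0 fL rE; rewrite (sum_ffun_update i).
have NR0 : 0 < N%:R :> R by rewrite ltr0n.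
have r0 : 0 < r by rewrite rE divr_gt0// mulr_gt0.
rewrite [leRHS](_ : _ = \sum_(k : {ffun 'I_d -> 'I_(N ^ 2)})
    (N%:R * (2 * (L * r)))); last first.
  by rewrite sumr_const card_ffun !card_ord mulr_natl.
apply: ler_sum => k _.
pose w := 2 * a / (N ^ 2)%:R.
have rw : r = N%:R * w by rewrite rE /w natrX; field; rewrite gt_eqF.
pose e : V := delta_mx ord0 i.
pose b := corner a k - ((k i)%:R * w) *: e.
pose A (j : nat) := f (b + (j%:R * w) *: e) - f (b + (j%:R * w - r) *: e).
have AB j : `|A j| <= L * r.
  apply: le_trans (fL _ _) _; rewrite opprD addrACA subrr add0r -scalerBl.
  by rewrite l1_norm_shift opprB addrCA subrr addr0 gtr0_norm.
apply: le_trans (sum_shift_le (N ^ 2) N AB); rewrite le_eqVlt; apply/orP; left.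
apply/eqP; apply: eq_bigr => j _; rewrite /A /second_diff.
have -> : corner a [ffun l => if l == i then j else k l] = b + (j%:R * w) *: e.
  apply/rowP => l; rewrite !mxE !ffunE eqxx /=; case: eqVneq => [->|_].
    by rewrite (_ : true%:R = 1 :> R)// /w; ring.
  by rewrite (_ : false%:R = 0 :> R)//; ring.
rewrite -!addrA -scalerDl -scalerBl -/e.
have -> : (j + N)%:R * w = j%:R * w + r by rewrite natrD mulrDl rw.
by rewrite addrK; ring.
Qed.

(** A cell lies in a closed box, whose Lebesgue measure is the product of its sides. *)
Lemma measure_cell_le (mu : probability V R) (M a : R) n
    (k : {ffun 'I_d -> 'I_n}) : 0 < a -> (0 < n)%N ->
  (forall A : set V, measurable A -> (mu A <= M%:E * lebesgue_rV A)%E) ->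
  (mu (cell a k) <= (M * (2 * a / n%:R) ^+ d)%:E)%E.
Proof.
move=> a0 n0 muM; pose w := 2 * a / n%:R.
have w0 : 0 < w by rewrite divr_gt0// ?mulr_gt0 ?ltr0n.
pose c' : V := \row_i (corner a k ord0 i + w).
pose box : set V := [set x | forall i, corner a k ord0 i <= x ord0 i <= c' ord0 i].
have mbox : measurable box.
  rewrite (_ : box = \bigcap_(i in [set: 'I_d])
    ((fun x : V => x ord0 i) @^-1` `[corner a k ord0 i, c' ord0 i])).
    apply: fin_bigcap_measurable => // i _; rewrite -[X in measurable X]setTI.
    exact: measurable_coord.
  apply/seteqP; split => x h i; first by move=> _; rewrite /= in_itv; exact: h.
  by have := h i Logic.I; rewrite /= in_itv.
apply: (@le_trans _ _ (mu box)).
  apply: le_measure; rewrite ?inE//; first exact: measurable_cell.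
  by move=> x /= h i; have /andP[h1 h2] := h i; rewrite h1 [leRHS]mxE ltW.
apply: le_trans (muM _ mbox) _; rewrite lebesgue_rV_box; last first.
  by move=> i; rewrite [leRHS]mxE lerDl ltW.
rewrite -EFinM lee_fin (eq_bigr (fun=> w)).
  by rewrite prodr_const card_ord.
by move=> i _; rewrite [X in X - _]mxE addrC addKr.
Qed.

(** Replacing the integrand by its value at the corners of the cells costs the
    Lipschitz constant times the side w = r^2 / (2a) of the cells, that is O(r^2);
    this is what fixes their number.  The Riemann sum that remains telescopes. *)
Lemma integral_second_diff_le (mu : probability V R) (L M a r : R) N (i : 'I_d) f :
  0 < a -> (0 < N)%N -> 0 <= L -> 0 <= M ->
  concentrated_on mu (eucl_ball a) ->
  (forall A : set V, measurable A -> (mu A <= M%:E * lebesgue_rV A)%E) ->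
  l1_lipschitz L f -> (forall x h, 0 <= second_diff f h x) ->
  r = 2 * a / N%:R ->
  (\int[mu]_x (second_diff f (r *: delta_mx ord0 i) x)%:E <=
   (M * (2 * a) ^+ d / (2 * a) * L * (4 * d%:R + 2) * r ^+ 2)%:E)%E.
Proof.
move=> a0 N0 L0 M0 muc muM fL f0 rE.
set g := second_diff f _; pose n := (N ^ 2)%N.
have NR0 : 0 < N%:R :> R by rewrite ltr0n.
have n0 : (0 < n)%N by rewrite expn_gt0 N0.
pose w := 2 * a / n%:R; have w0 : 0 < w by rewrite divr_gt0// ?mulr_gt0 ?ltr0n.
have gL : l1_lipschitz (4 * L) g by exact: second_diff_lipschitz.
have mg : measurable_fun setT g by exact: l1_lipschitz_measurable gL.
have g0 x : 0 <= g x by exact: f0.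
pose eta := 4 * L * (d%:R * w).
have eta0 : 0 <= eta by rewrite !mulr_ge0// ltW.
pose c (k : {ffun 'I_d -> 'I_n}) := g (corner a k) + eta.
have c0 k : 0 <= c k by rewrite addr_ge0.
have cellg k x : cell a k x -> g x <= c k.
  move=> kx; have := gL x (corner a k); rewrite ler_norml => /andP[_].
  have : l1_norm (x - corner a k) <= d%:R * w.
    rewrite /l1_norm; apply: (@le_trans _ _ (\sum_(j < d) w)); last first.
      by rewrite sumr_const card_ord -[leLHS]mulr_natl.
    apply: ler_sum => j _; rewrite mxE [X in _ + X]mxE.
    exact: cell_diam j kx (corner_cell k a0 n0).
  have L4 : 0 <= 4 * L by rewrite mulr_ge0.
  by move=> /(ler_wpM2l L4); rewrite /c /eta; lra.
apply: (@le_trans _ _ (\int[mu]_x (\sum_k (c k * \1_(cell a k) x)%:E))%E).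
  apply: ae_ge0_le_integral => //.
  - by move=> x _; rewrite lee_fin.
  - exact/measurable_EFinP.
  - by move=> x _; apply: sume_ge0 => k _; rewrite lee_fin mulr_ge0.
  - apply: emeasurable_sum => k; apply/measurable_EFinP; apply: measurable_funM => //.
    by apply: measurable_indic; exact: measurable_cell.
  exists (~` eucl_ball a); split => //.
    by apply: measurableC; exact: measurable_eucl_ball.
  move=> x /= h xa; apply: h => _.
  have [k kx] := cell_cover a0 n0 (fun j => eucl_ball_coord j xa).
  rewrite (bigD1 k)//= indicE mem_set// mulr1.
  apply: (@le_trans _ _ (c k)%:E); first by rewrite lee_fin; exact: cellg.
  by rewrite leeDl// sume_ge0// => l _; rewrite lee_fin mulr_ge0.
rewrite ge0_integral_sum//; last 2 first.
  - move=> k; apply/measurable_EFinP; apply: measurable_funM => //.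
    by apply: measurable_indic; exact: measurable_cell.
  - by move=> k x _; rewrite lee_fin mulr_ge0.
apply: (@le_trans _ _ (\sum_k (c k * (M * w ^+ d))%:E)%E).
  apply: lee_sum => k _.
  under eq_integral do rewrite EFinM.
  rewrite ge0_integralZl//; last 2 first.
  - by apply/measurable_EFinP; apply: measurable_indic; exact: measurable_cell.
  - by rewrite lee_fin.
  rewrite integral_indic//; last exact: measurable_cell.
  by rewrite setIT EFinM lee_wpmul2l ?lee_fin//; exact: measure_cell_le.
rewrite sumEFin lee_fin -mulr_suml big_split /= sumr_const card_ffun !card_ord.
have := sum_second_diff_cells i a0 N0 fL rE.
rewrite -/n -/g => h.
rewrite -(mulr_natl eta).
have nR : n%:R = N%:R ^+ 2 :> R by rewrite natrX.
have wr : w = r ^+ 2 / (2 * a).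
  by rewrite /w nR rE; field; rewrite !gt_eqF.
have nd : (n ^ d)%:R * w ^+ d = (2 * a) ^+ d.
  by rewrite natrX -exprMn /w mulrC divfK// gt_eqF// ltr0n.
have P0 : 0 <= M * w ^+ d by rewrite mulr_ge0// exprn_ge0// ltW.
apply: (@le_trans _ _ ((((n ^ d)%:R * (N%:R * (2 * (L * r)))) / n%:R +
    (n ^ d)%:R * eta) * (M * w ^+ d))).
  rewrite ler_wpM2r// lerD2r ler_pdivlMr ?ltr0n// mulrC; exact: h.
rewrite le_eqVlt; apply/orP; left; apply/eqP.
transitivity (M * ((n ^ d)%:R * w ^+ d) * ((N%:R * (2 * (L * r))) / n%:R + eta)).
  by ring.
rewrite nd nR /eta wr rE; field; by rewrite !gt_eqF.
Qed.

End second_difference.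

(** * Displacement of subgradients *)

Section truncated_potential.
Context (R : realType) (d : nat).
Local Notation V := ('rV[R]_d).
Implicit Types (x y h : V) (c : V -> R).

(** The restriction to a ball makes the conjugate of c finite and Lipschitz on the whole
    space.  For c = phi^* it stays below phi, and meets phi at x as soon as phi has a
    subgradient of norm less than b at x. *)
Definition ball_conj c (b : R) x : R :=
  sup [set dotp x y - c y | y in eucl_ball b].

Variables (c : V -> R) (b K : R).
Hypotheses (b0 : 0 < b) (cK : forall y, eucl_ball b y -> `|c y| <= K).
Local Notation f := (ball_conj c b).

Let has_sup_conj x : has_sup [set dotp x y - c y | y in eucl_ball b].
Proof.
split; first by exists (dotp x 0 - c 0), 0 => //; exact: eucl_ball0.
exists (b * l1_norm x + K) => _ [y yb <-].
apply: lerD; last by apply: le_trans (cK yb); rewrite -normrN ler_norm.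
apply: le_trans (ler_norm _) _; apply: ler_dotp_l1 => i.
exact/ltW/eucl_ball_coord.
Qed.

Lemma ball_conj_ge x y : eucl_ball b y -> dotp x y - c y <= f x.
Proof. by move=> yb; apply: (sup_ubound (has_sup_conj x).2); exists y. Qed.

Lemma ball_conj_le x u : (forall y, eucl_ball b y -> dotp x y - c y <= u) ->
  f x <= u.
Proof.
move=> h; apply: ge_sup; first by case: (has_sup_conj x).
by move=> _ [y yb <-]; exact: h.
Qed.

Lemma ball_conj_lipschitz : l1_lipschitz b f.
Proof.
have H x y : f x - f y <= b * l1_norm (x - y).
  rewrite lerBlDr; apply: ball_conj_le => z zb.
  have := ball_conj_ge y zb.
  have := ler_dotp_l1 (x - y) (fun i => ltW (eucl_ball_coord i zb)).
  by rewrite dotpBl ler_norml => /andP[]; lra.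
move=> x y; rewrite ler_norml H andbT lerNl opprB.
rewrite (_ : l1_norm (x - y) = l1_norm (y - x)) ?H//.
by apply: eq_bigr => i _; rewrite !mxE distrC.
Qed.

Lemma ball_conj_second_diff_ge0 x h : 0 <= second_diff f h x.
Proof.
rewrite /second_diff subr_ge0 -ler_pdivlMl//; apply: ball_conj_le => y yb.
have := ball_conj_ge (x + h) yb; have := ball_conj_ge (x - h) yb.
by rewrite dotpBl dotpDl; lra.
Qed.

(** Of the two points x + r u and x - r u, u the i-th coordinate vector, one is tested
    against the affine minorant of slope yt and the other against the one of slope y,
    according to the sign of the difference of the i-th coordinates. *)
Lemma subgradient_displacement x y xt yt (p e r : R) i :
  eucl_ball b y -> eucl_ball b yt -> f x <= dotp x y - c y ->
  f xt <= p -> p + c yt - dotp xt yt = e -> 0 <= r ->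
  r * `|y ord0 i - yt ord0 i| <=
    second_diff f (r *: delta_mx ord0 i) x + e + 2 * b * l1_norm (x - xt).
Proof.
move=> yb ytb fx fp pe r0.
have fge (t : R) : dotp x yt + t * yt ord0 i - c yt <= f (x + t *: delta_mx ord0 i).
  by have := ball_conj_ge (x + t *: delta_mx ord0 i) ytb; rewrite dotpDl dotpZl dotp_delta.
have fge' (t : R) : dotp x y + t * y ord0 i - c y <= f (x + t *: delta_mx ord0 i).
  by have := ball_conj_ge (x + t *: delta_mx ord0 i) yb; rewrite dotpDl dotpZl dotp_delta.
have fxt := ball_conj_ge xt yb.
have hd : `|dotp (x - xt) (yt - y)| <= 2 * b * l1_norm (x - xt).
  apply: ler_dotp_l1 => j; rewrite !mxE.
  have := eucl_ball_coord j yb; have := eucl_ball_coord j ytb.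
  by rewrite !ltr_norml ler_norml => /andP[? ?] /andP[? ?]; apply/andP; split; lra.
move: hd; rewrite dotpBr !dotpBl ler_norml => /andP[hd1 hd2].
have h1 := fge r; have h2 := fge (- r); have h3 := fge' r; have h4 := fge' (- r).
rewrite /second_diff -scaleNr.
by case: (ger0P (y ord0 i - yt ord0 i)) => h; lra.
Qed.

End truncated_potential.

(** * Gluing couplings *)

Section gluing.
Local Open Scope ereal_scope.

Lemma measure_partition dd (T : measurableType dd) (R : realType)
    (m : {measure set T -> \bar R}) (I : finType) (F : I -> set T)
    (N A : set T) :
  (forall i, measurable (F i)) -> (forall i j x, F i x -> F j x -> i = j) ->
  measurable N -> m N = 0 -> (forall x, ~ N x -> exists i, F i x) ->
  measurable A -> \sum_i m (A `&` F i) = m A.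
Proof.
move=> mF dF mN N0 cF mA.
have mAF i : measurable (A `&` F i) by exact: measurableI.
have mI i : measurable_fun setT (fun x => (\1_(A `&` F i) x)%:E : \bar R).
  by apply/measurable_EFinP; exact: measurable_indic.
transitivity (\sum_i \int[m]_x (\1_(A `&` F i) x)%:E).
  by apply: eq_bigr => i _; rewrite integral_indic ?setIT.
rewrite -ge0_integral_sum// -[in RHS](setIT A) -integral_indic//.
apply: ae_eq_integral => //.
- exact: emeasurable_sum.
- by apply/measurable_EFinP; exact: measurable_indic.
exists N; split => // x /= h; apply: contrapT => Nx; apply: h => _.
have [i Fi] := cF x Nx.
have [Ax|Ax] := boolP (x \in A); last first.
  rewrite big1 ?indicE ?(negPf Ax)// => j _; rewrite indicE.
  by rewrite memNset// => -[/mem_set]; rewrite (negPf Ax).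
rewrite (bigD1 i)//= big1 ?adde0.
  by rewrite !indicE Ax mem_set//; split => //; exact: set_mem.
move=> j ji; rewrite indicE memNset// => -[_ Fj].
by move: ji; rewrite (dF _ _ _ Fj Fi) eqxx.
Qed.

Context (R : realType) (d : nat).
Local Notation V := ('rV[R]_d).

(** An approximation of the gluing along disintegrations of g and gt:
    x and xt are localised in grid cubes Q k and Q l, and g restricted to Q k is put
    next to gt restricted to Q l independently, with total mass p (Q k * Q l).  The
    marginals are exact; the displacement in x is changed by the size of the cubes. *)
Lemma glue_couplings (mu nu mut nut : probability V R)
    (g gt : probability (V * V)%type R) (p : probability (V * V)%type R)
    (a eta : R) : (0 < a)%R -> (0 < eta)%R ->
  concentrated_on mu (eucl_ball a) -> concentrated_on mut (eucl_ball a) ->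
  coupling mu nu g -> coupling mut nut gt -> coupling mu mut p ->
  exists G, coupling g gt G /\
    \int[G]_z (l1_norm (z.1.1 - z.2.1))%:E <=
    \int[p]_z (l1_norm (z.1 - z.2))%:E + eta%:E.
Proof.
move=> a0 eta0 cmu cmut [g1 g2] [gt1 gt2] [p1 p2].
pose n := (Num.truncn (8 * d%:R * a / eta)).+1.
have n0 : (0 < n)%N by [].
have nR0 : (0 < n%:R :> R)%R by rewrite ltr0n.
pose w := (2 * a / n%:R)%R.
have weta : (4 * (d%:R * w) <= eta)%R.
  rewrite /w (_ : 4 * _ = 8 * d%:R * a / n%:R)%R; last by field; rewrite gt_eqF.
  rewrite ler_pdivrMr// (mulrC eta) -ler_pdivrMr//; exact/ltW/truncnS_gt.
pose I := {ffun 'I_d -> 'I_n}.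
pose Q (k : I) : set V := cell a k.
have mQ k : measurable (Q k) by exact: measurable_cell.
have mB : measurable (@eucl_ball R d a) by exact: measurable_eucl_ball.
have mfst (A : set V) : measurable A -> measurable (fst @^-1` A : set (V * V)).
  by move=> mA; rewrite -[X in measurable X]setTI; exact: measurable_fst.
have msnd (A : set V) : measurable A -> measurable (snd @^-1` A : set (V * V)).
  by move=> mA; rewrite -[X in measurable X]setTI; exact: measurable_snd.
have part (m : probability (V * V)%type R) (X : V * V -> V) (A : set (V * V)) :
    (forall B, measurable B -> measurable (X @^-1` B)) ->
    m (X @^-1` (~` eucl_ball a)) = 0 -> measurable A ->
    \sum_(k : I) m (A `&` X @^-1` Q k) = m A.
  move=> mX X0 mA.
  apply: (@measure_partition _ _ _ m I (fun k => X @^-1` Q k)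
    (X @^-1` (~` eucl_ball a))) => //.
  - by move=> k; exact: mX.
  - by move=> i j x; exact: cell_inj.
  - by apply: mX; exact: measurableC.
  move=> x /= /contrapT xa.
  exact: (cell_cover a0 n0 (fun i => eucl_ball_coord i xa)).
have part1 (A : set (V * V)) : measurable A ->
    \sum_(k : I) g (A `&` fst @^-1` Q k) = g A.
  by apply: part => //; rewrite g1//; exact: measurableC.
have part2 (A : set (V * V)) : measurable A ->
    \sum_(k : I) gt (A `&` fst @^-1` Q k) = gt A.
  by apply: part => //; rewrite gt1//; exact: measurableC.
have part3 (A : set (V * V)) : measurable A ->
    \sum_(k : I) p (A `&` fst @^-1` Q k) = p A.
  by apply: part => //; rewrite p1//; exact: measurableC.
have part4 (A : set (V * V)) : measurable A ->
    \sum_(k : I) p (A `&` snd @^-1` Q k) = p A.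
  by apply: part => //; rewrite p2//; exact: measurableC.
pose qg (A : set (V * V)) := fine (g A).
pose qt (A : set (V * V)) := fine (gt A).
pose qp (A : set (V * V)) := fine (p A).
have gE A : measurable A -> g A = (qg A)%:E.
  by move=> mA; rewrite /qg fineK// fin_num_measure.
have tE A : measurable A -> gt A = (qt A)%:E.
  by move=> mA; rewrite /qt fineK// fin_num_measure.
have pE A : measurable A -> p A = (qp A)%:E.
  by move=> mA; rewrite /qp fineK// fin_num_measure.
pose u k := qg (fst @^-1` Q k); pose v k := qt (fst @^-1` Q k).
pose r k l := qp (fst @^-1` Q k `&` snd @^-1` Q l).
have mr k l : measurable (fst @^-1` Q k `&` snd @^-1` Q l : set (V * V)).
  by apply: measurableI; [exact: mfst|exact: msnd].
have r0 k l : (0 <= r k l)%R by exact: fine_ge0.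
have u0 k : (0 <= u k)%R by exact: fine_ge0.
have v0 k : (0 <= v k)%R by exact: fine_ge0.
have sumr_l k : (\sum_l r k l = u k)%R.
  apply: EFin_inj; rewrite -sumEFin.
  rewrite (eq_bigr (fun l => p (fst @^-1` Q k `&` snd @^-1` Q l))); last first.
    by move=> l _; rewrite pE.
  rewrite part4; last exact: mfst.
  by rewrite p1// -gE; [rewrite g1|exact: mfst].
have sumr_k l : (\sum_k r k l = v l)%R.
  apply: EFin_inj; rewrite -sumEFin.
  rewrite (eq_bigr (fun k => p (snd @^-1` Q l `&` fst @^-1` Q k))); last first.
    by move=> k _; rewrite setIC pE.
  rewrite part3; last exact: msnd.
  by rewrite p2// -tE; [rewrite gt1|exact: mfst].
have ru k l : u k = 0%R -> r k l = 0%R.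
  move=> uk; apply/eqP; rewrite eq_le r0 andbT -uk -sumr_l.
  by rewrite (bigD1 l)//= lerDl sumr_ge0.
have rv k l : v l = 0%R -> r k l = 0%R.
  move=> vl; apply/eqP; rewrite eq_le r0 andbT -vl -sumr_k.
  by rewrite (bigD1 k)//= lerDl sumr_ge0.
pose c (kl : I * I) := (r kl.1 kl.2 / (u kl.1 * v kl.2))%R.
have c0 kl : (0 <= c kl)%R by rewrite divr_ge0// mulr_ge0.
(* Inverting zero does no harm: a cube without mass receives none from p. *)
have cu k l : (c (k, l) * u k * v l = r k l)%R.
  rewrite /c /=; have [uk|uk] := eqVneq (u k) 0%R.
    by rewrite uk ru// !mulr0 mul0r.
  have [vl|vl] := eqVneq (v l) 0%R; first by rewrite vl rv// !mulr0.
  by field; rewrite uk vl.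
have mfst' := mfst.
pose m (kl : I * I) : {measure set ((V * V) * (V * V)) -> \bar R} :=
  mscale (NngNum (c0 kl))
    (mrestr g (mfst _ (mQ kl.1)) \x mrestr gt (mfst _ (mQ kl.2))).
have mE kl A B : measurable A -> measurable B -> m kl (A `*` B) =
    (c kl * (qg (A `&` fst @^-1` Q kl.1) * qt (B `&` fst @^-1` Q kl.2)))%:E.
  move=> mA mB'; rewrite (_ : m kl (A `*` B) = (c kl)%:E *
    (mrestr g (mfst _ (mQ kl.1)) \x mrestr gt (mfst _ (mQ kl.2))) (A `*` B))//.
  rewrite product_measure1E//.
  transitivity ((c kl)%:E * (g (A `&` fst @^-1` Q kl.1) * gt (B `&` fst @^-1` Q kl.2))) => //.
  by rewrite gE ?tE//; apply: measurableI => //; exact: mfst'.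
have m1 (A : set (V * V)) : measurable A -> fin_msum m (fst @^-1` A) = g A.
  move=> mA; rewrite fin_msumE (_ : fst @^-1` A = A `*` setT); last first.
    by apply/seteqP; split => -[? ?]//= [].
  under eq_bigr do rewrite mE// setTI -/(v _).
  rewrite -(pair_big xpredT xpredT (fun k l => (c (k, l) * (qg (A `&` fst @^-1` Q k) * v l))%:E)) /=.
  rewrite -[RHS]part1//; apply: eq_bigr => k _.
  have mAk : measurable (A `&` fst @^-1` Q k) by apply: measurableI => //; exact: mfst'.
  rewrite sumEFin gE//; congr EFin.
  have [uk|uk] := eqVneq (u k) 0%R.
    have -> : qg (A `&` fst @^-1` Q k) = 0%R.
      apply/eqP; rewrite eq_le fine_ge0// andbT -uk; apply: fine_le.
      - exact: fin_num_measure.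
      - by apply: fin_num_measure; exact: mfst'.
      by apply: le_measure; rewrite ?inE//; exact: mfst'.
    by apply: big1 => l _; rewrite mul0r mulr0.
  rewrite (eq_bigr (fun l => qg (A `&` fst @^-1` Q k) / u k * r k l)%R).
    by rewrite -mulr_sumr sumr_l divfK.
  by move=> l _; rewrite -cu; field.
have m2 (A : set (V * V)) : measurable A -> fin_msum m (snd @^-1` A) = gt A.
  move=> mA; rewrite fin_msumE (_ : snd @^-1` A = setT `*` A); last first.
    by apply/seteqP; split => -[? ?]//= [].
  under eq_bigr do rewrite mE// setTI -/(u _).
  rewrite -(pair_big xpredT xpredT (fun k l => (c (k, l) * (u k * qt (A `&` fst @^-1` Q l)))%:E)) /=.
  rewrite exchange_big /= -[RHS]part2//; apply: eq_bigr => l _.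
  have mAl : measurable (A `&` fst @^-1` Q l) by apply: measurableI => //; exact: mfst'.
  rewrite sumEFin tE//; congr EFin.
  have [vl|vl] := eqVneq (v l) 0%R.
    have -> : qt (A `&` fst @^-1` Q l) = 0%R.
      apply/eqP; rewrite eq_le fine_ge0// andbT -vl; apply: fine_le.
      - exact: fin_num_measure.
      - by apply: fin_num_measure; exact: mfst'.
      by apply: le_measure; rewrite ?inE//; exact: mfst'.
    by apply: big1 => k _; rewrite !mulr0.
  rewrite (eq_bigr (fun k => qt (A `&` fst @^-1` Q l) / v l * r k l)%R).
    by rewrite -mulr_sumr sumr_k divfK.
  by move=> k _; rewrite -cu; field.
have mT : fin_msum m setT = 1.
  by rewrite -(preimage_setT (@fst (V * V) (V * V))) m1// probability_setT.
exists (prob_of mT); split; first by split.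
have ml1 : measurable_fun setT (fun z : V * V => l1_norm (z.1 - z.2)).
  rewrite /l1_norm; apply: measurable_sum => i; apply: measurableT_comp => //.
  rewrite (_ : (fun z : V * V => _) = fun z => z.1 ord0 i - z.2 ord0 i)%R; last first.
    by apply/funext => z; rewrite !mxE.
  apply: measurable_funB.
    exact: (measurableT_comp (measurable_coord i) measurable_fst).
  exact: (measurableT_comp (measurable_coord i) measurable_snd).
have mcost : measurable_fun setT
    (fun z : (V * V) * (V * V) => (l1_norm (z.1.1 - z.2.1))%:E).
  have mX : measurable_fun setT (fun z : (V * V) * (V * V) => (z.1.1, z.2.1)).
    apply/measurable_fun_pairP; split => /=.
      exact: (measurableT_comp measurable_fst measurable_fst).
    exact: (measurableT_comp measurable_fst measurable_snd).
  by apply/measurable_EFinP; exact: (measurableT_comp ml1 mX).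
have cell_l1 k l x y x' y' : Q k x -> Q k x' -> Q l y -> Q l y' ->
    (l1_norm (x - y) <= l1_norm (x' - y') + 2 * (d%:R * w))%R.
  move=> kx kx' ly ly'.
  rewrite (_ : 2 * (d%:R * w) = \sum_(i < d) (2 * w))%R; last first.
    by rewrite sumr_const card_ord -[RHS]mulr_natl; ring.
  rewrite /l1_norm -big_split /=; apply: ler_sum => i _.
  rewrite !coordB.
  have h1 := cell_diam i kx kx'; have h2 := cell_diam i ly ly'.
  rewrite (_ : x ord0 i - y ord0 i = (x' ord0 i - y' ord0 i) +
    ((x ord0 i - x' ord0 i) - (y ord0 i - y' ord0 i)))%R; last by ring.
  apply: le_trans (ler_normD _ _) _; rewrite lerD2l.
  apply: le_trans (ler_normB _ _) _.
  by rewrite mulr_natl mulr2n lerD.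
pose up (kl : I * I) := (l1_norm (corner a kl.1 - corner a kl.2) + 2 * (d%:R * w))%R.
have w0 : (0 <= d%:R * w)%R by rewrite mulr_ge0// divr_ge0// mulr_ge0// ltW.
have up0 kl : (0 <= up kl)%R by rewrite addr_ge0 ?l1_norm_ge0// mulr_ge0.
rewrite [leLHS](_ : _ = \int[fin_msum m]_z (l1_norm (z.1.1 - z.2.1))%:E)//.
rewrite ge0_integral_fin_msum//; last by move=> z; rewrite lee_fin l1_norm_ge0.
pose Rk (kl : I * I) := fst @^-1` Q kl.1 `&` snd @^-1` Q kl.2 : set (V * V).
apply: (@le_trans _ _ (\sum_kl ((up kl)%:E * p (Rk kl)))).
  apply: lee_sum => kl _.
  have -> : (up kl)%:E * p (Rk kl) = (up kl)%:E * m kl setT.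
    rewrite -setXTT mE// !setTI (pE _ (mr kl.1 kl.2)) -/(r _ _) -/(u _) -/(v _).
    by rewrite -cu -surjective_pairing mulrA.
  pose A : set (V * V) := fst @^-1` Q kl.1; pose B : set (V * V) := fst @^-1` Q kl.2.
  have mA : measurable A by exact: mfst'.
  have mB' : measurable B by exact: mfst'.
  apply: (le_integral_cst (A := A `*` B)) => //.
  - exact: measurableX.
  - have -> : ~` (A `*` B) = ((~` A) `*` setT) `|` (setT `*` (~` B)).
      apply/seteqP; split => -[x y] /=.
        by move/not_andP => [?|?]; [left|right].
      by move=> [[h1 _]|[_ h1]] [].
    have mCA : measurable (~` A) by exact: measurableC.
    have mCB : measurable (~` B) by exact: measurableC.
    apply: null_set_setU; [exact: measurableX|exact: measurableX| |].
    + apply: etrans (mE _ _ _ mCA measurableT) _.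
      by rewrite setICl /qg measure0 /= mul0r mulr0.
    + apply: etrans (mE _ _ _ measurableT mCB) _.
      by rewrite setICl /qt measure0 /= mulr0 mulr0.
  - by move=> z; rewrite lee_fin l1_norm_ge0.
  - by rewrite lee_fin.
  move=> [z zt] [/= Az Bz]; rewrite lee_fin.
  by apply: cell_l1 Az _ Bz _; exact: corner_cell.
rewrite (eq_bigr (fun kl => \int[p]_z ((up kl)%:E * (\1_(Rk kl) z)%:E))); last first.
  move=> kl _; rewrite ge0_integralZl ?lee_fin//.
    by rewrite integral_indic ?setIT//; exact: mr.
  by apply/measurable_EFinP; apply: measurable_indic; exact: mr.
rewrite -ge0_integral_sum//; last 2 first.
- move=> kl; apply: measurable_funeM; apply/measurable_EFinP.
  by apply: measurable_indic; exact: mr.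
- by move=> kl z _; rewrite mule_ge0 ?lee_fin.
rewrite -[eta%:E]mule1 -(probability_setT p) -integral_cst//.
have l10 (z : V * V) : 0 <= (l1_norm (z.1 - z.2))%:E.
  by rewrite lee_fin l1_norm_ge0.
have ml1E : measurable_fun setT (fun z : V * V => (l1_norm (z.1 - z.2))%:E).
  exact/measurable_EFinP.
have e0 (z : V * V) : 0 <= cst eta%:E z by rewrite lee_fin ltW.
rewrite -(@ge0_integralD _ _ _ p setT measurableT _ (cst eta%:E)
  (fun z _ => l10 z) ml1E (fun z _ => e0 z) (measurable_cst _)).
apply: ge0_le_integral => //.
- by move=> z _; apply: sume_ge0 => kl _; rewrite mule_ge0 ?lee_fin.
- apply: emeasurable_sum => kl; apply: measurable_funeM; apply/measurable_EFinP.
  by apply: measurable_indic; exact: mr.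
- exact: emeasurable_funD.
move=> z _.
have [[kl Rz]|nR] := pselect (exists kl, Rk kl z); last first.
  rewrite big1; first by rewrite adde_ge0 ?lee_fin ?l1_norm_ge0// ltW.
  by move=> kl _; rewrite indicE memNset ?mule0// => h; apply: nR; exists kl.
rewrite (bigD1 kl)//= big1 ?adde0.
  rewrite indicE mem_set// mule1 -EFinD lee_fin.
  have := @cell_l1 _ _ (corner a kl.1) (corner a kl.2) z.1 z.2
    (corner_cell _ a0 n0) Rz.1 (corner_cell _ a0 n0) Rz.2.
  by rewrite /up; lra.
move=> kl' ne; rewrite indicE memNset ?mule0// => -[h1 h2].
move: ne; rewrite (_ : kl' = kl) ?eqxx//.
rewrite (surjective_pairing kl) (surjective_pairing kl').
by rewrite (cell_inj a0 n0 h1 Rz.1) (cell_inj a0 n0 h2 Rz.2).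
Qed.

End gluing.

(** * The stability estimate *)

Lemma ge0_integral_coupling_fst d1 d2 (T1 : measurableType d1)
    (T2 : measurableType d2) (R : realType) (P : probability T1 R)
    (Q : probability T2 R) (g : probability (T1 * T2)%type R) (u : T1 -> \bar R) :
  coupling P Q g -> measurable_fun setT u -> (forall x, 0 <= u x)%E ->
  (\int[g]_z u z.1 = \int[P]_x u x)%E.
Proof.
move=> [gP _] mu u0.
transitivity (\int[push_measure g measurable_fst]_x u x)%E; last first.
  by apply: eq_measure_integral => A mA _; exact: gP.
exact: esym (ge0_integral_pushforward measurable_fst g measurableT mu (fun x _ => u0 x)).
Qed.

Lemma ge0_integral_coupling_snd d1 d2 (T1 : measurableType d1)
    (T2 : measurableType d2) (R : realType) (P : probability T1 R)
    (Q : probability T2 R) (g : probability (T1 * T2)%type R) (u : T2 -> \bar R) :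
  coupling P Q g -> measurable_fun setT u -> (forall x, 0 <= u x)%E ->
  (\int[g]_z u z.2 = \int[Q]_x u x)%E.
Proof.
move=> [_ gQ] mu u0.
transitivity (\int[push_measure g measurable_snd]_x u x)%E; last first.
  by apply: eq_measure_integral => A mA _; exact: gQ.
exact: esym (ge0_integral_pushforward measurable_snd g measurableT mu (fun x _ => u0 x)).
Qed.

Section estimate.
Context (R : realType) (d : nat).
Local Notation V := ('rV[R]_d).

Lemma ball_sqr_dist_le_l1 (a : R) (x y : V) : eucl_ball a x -> eucl_ball a y ->
  eucl_dist x y ^+ 2 <= 2 * a * l1_norm (x - y).
Proof.
move=> xa ya; rewrite eucl_dist_sqr /l1_norm mulr_sumr; apply: ler_sum => i _.
rewrite coordB -real_normK ?num_real// expr2 ler_wpM2r//.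
have := eucl_ball_coord i xa; have := eucl_ball_coord i ya.
rewrite !ltr_norml ler_norml => /andP[? ?] /andP[? ?]; apply/andP; split; lra.
Qed.

Lemma ball_sqr_dist_le (a : R) (x y : V) : 0 <= a ->
  eucl_ball a x -> eucl_ball a y ->
  eucl_dist x y ^+ 2 <= 2 * a * (d%:R * (2 * a)).
Proof.
move=> a0 xa ya; apply: le_trans (ball_sqr_dist_le_l1 xa ya) _.
rewrite ler_wpM2l ?mulr_ge0// /l1_norm.
apply: (@le_trans _ _ (\sum_(i < d) (2 * a))); last first.
  by rewrite sumr_const card_ord -[leLHS]mulr_natl.
apply: ler_sum => i _; rewrite coordB.
have := eucl_ball_coord i xa; have := eucl_ball_coord i ya.
rewrite !ltr_norml ler_norml => /andP[? ?] /andP[? ?]; apply/andP; split; lra.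
Qed.

(** The arithmetic-geometric inequality in each coordinate.  Integrated with s slightly
    above W_2, it bounds the first moment by a multiple of s. *)
Lemma l1_norm_le_sqr_dist (s : R) (x y : V) : 0 < s ->
  l1_norm (x - y) <= (2 * s)^-1 * eucl_dist x y ^+ 2 + d%:R * s / 2.
Proof.
move=> s0; rewrite eucl_dist_sqr /l1_norm mulr_sumr.
rewrite (_ : d%:R * s / 2 = \sum_(i < d) (s / 2)); last first.
  by rewrite sumr_const card_ord -[RHS]mulr_natl mulrA.
rewrite -big_split /=; apply: ler_sum => i _; rewrite coordB.
rewrite -[in leRHS]real_normK ?num_real//; set u := `|_|.
rewrite -(ler_pM2l (_ : 0 < 2 * s)) ?mulr_gt0// mulrDr mulrA divff ?gt_eqF ?mulr_gt0//.
by have := sqr_ge0 (u - s); rewrite sqrrB; nra.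
Qed.

Lemma measurable_l1_normB dd (T : measurableType dd) (f g : T -> V) :
  measurable_fun setT f -> measurable_fun setT g ->
  measurable_fun setT (fun t => l1_norm (f t - g t)).
Proof.
move=> mf mg; apply: measurable_sum => i; apply: measurableT_comp => //.
rewrite (_ : (fun t => _) = fun t => f t ord0 i - g t ord0 i); last first.
  by apply/funext => z; rewrite coordB.
apply: measurable_funB.
  exact: (measurableT_comp (measurable_coord i) mf).
exact: (measurableT_comp (measurable_coord i) mg).
Qed.

Lemma measurable_eucl_dist_prod_sqr :
  measurable_fun setT (fun z : (V * V) * (V * V) =>
    (eucl_dist_prod z.1 z.2 ^+ 2)%:E).
Proof.
apply/measurable_EFinP.
rewrite (_ : (fun z => _) = fun z : (V * V) * (V * V) =>
    eucl_dist z.1.1 z.2.1 ^+ 2 + eucl_dist z.1.2 z.2.2 ^+ 2); last first.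
  by apply/funext => z; rewrite sqr_sqrtr ?addr_ge0 ?sqr_ge0.
apply: measurable_funD; apply: measurable_eucl_dist_sqr.
- exact: (measurableT_comp measurable_fst measurable_fst).
- exact: (measurableT_comp measurable_fst measurable_snd).
- exact: (measurableT_comp measurable_snd measurable_fst).
- exact: (measurableT_comp measurable_snd measurable_snd).
Qed.

(** The pointwise bound, integrated against a coupling G of g and gt: the terms are the
    displacement in x, the second differences of f, and the duality gap. *)
Lemma coupling_cost_le (mu nu : probability V R) (phi : V -> \bar R)
    (g gt : probability (V * V)%type R)
    (G : probability ((V * V) * (V * V))%type R) (a b M E s r : R) N (S St : set (V * V)) :
  0 < a -> 0 < b -> 0 < M -> (0 < N)%N -> r = 2 * a / N%:R ->
  concentrated_on mu (eucl_ball a) ->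
  (forall A : set V, measurable A -> (mu A <= M%:E * lebesgue_rV A)%E) ->
  lipschitz_class (4 * a) (4 * b) phi ->
  coupling mu nu g ->
  measurable S -> g (~` S) = 0%E ->
  (forall z, S z -> eucl_ball a z.1 /\ eucl_ball b z.2) ->
  (forall z, S z -> (phi z.1 + fenchel_conj phi z.2 = (dotp z.1 z.2)%:E)%E) ->
  measurable St -> gt (~` St) = 0%E ->
  (forall z, St z -> eucl_ball a z.1 /\ eucl_ball b z.2) ->
  (\int[gt]_z duality_gap phi z = E%:E)%E ->
  coupling g gt G ->
  (\int[G]_z (l1_norm (z.1.1 - z.2.1))%:E <= s%:E)%E ->
  (\int[G]_z (eucl_dist_prod z.1 z.2 ^+ 2)%:E <=
    ((2 * a + 2 * b / r * (2 * b * d%:R)) * s +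
     d%:R * (2 * b / r * (M * (2 * a) ^+ d / (2 * a) * b * (4 * d%:R + 2) * r ^+ 2)) +
     2 * b / r * d%:R * E)%:E)%E.
Proof.
move=> a0 b0 M0 N0 rE muc muM [[phip phil phic] [phifin phiL] [psifin psiL]] gc
  mS gS Sab SE mSt gSt Stab gapE Gc Gs.
have NR0 : 0 < N%:R :> R by rewrite ltr0n.
have r0 : 0 < r by rewrite rE divr_gt0// mulr_gt0.
have a4 : a <= 4 * a by lra.
have b4 : b <= 4 * b by lra.
have [K psiK] := lipschitz_real_on_bounded (lt_le_trans b0 b4) (conj psifin psiL).
pose c y := fine (fenchel_conj phi y).
have cK y : eucl_ball b y -> `|c y| <= K.
  move=> /(eucl_ball_le b4) yb; have := psiK y yb; have := psifin y yb.
  by rewrite /c; case: (fenchel_conj phi y).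
pose f := ball_conj c b.
have fphi x p : phi x = p%:E -> f x <= p.
  move=> xp; apply: (ball_conj_le b0 cK) => y /(eucl_ball_le b4) yb.
  have := fenchel_young x y phip; rewrite xp /c; have := psifin y yb.
  by case: (fenchel_conj phi y) => // t _; rewrite -EFinD lee_fin /=; lra.
have fL : l1_lipschitz b f by exact: ball_conj_lipschitz b0 cK.
have f2 x h : 0 <= second_diff f h x by exact: ball_conj_second_diff_ge0 b0 cK _ _.
pose e i : V := r *: delta_mx ord0 i.
pose l1 (z : (V * V) * (V * V)) : R := l1_norm (z.1.1 - z.2.1).
have l10 z : 0 <= l1 z by exact: l1_norm_ge0.
have br0 : 0 <= 2 * b / r by rewrite divr_ge0 ?mulr_ge0// ltW.
pose A := 2 * a + 2 * b / r * (2 * b * d%:R).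
have [a0' b0'] := (ltW a0, ltW b0).
have A0 : 0 <= A.
  apply: addr_ge0; first exact: mulr_ge0.
  by do 2 (apply: mulr_ge0 => //); exact: mulr_ge0.
pose F1 (z : (V * V) * (V * V)) := (A%:E * (l1 z)%:E)%E.
pose F2 (z : (V * V) * (V * V)) :=
  (\sum_(i < d) ((2 * b / r)%:E * (second_diff f (e i) z.1.1)%:E))%E.
pose F3 (z : (V * V) * (V * V)) := ((2 * b / r * d%:R)%:E * duality_gap phi z.2)%E.
have ml1 : measurable_fun setT (fun z => (l1 z)%:E).
  apply/measurable_EFinP; apply: measurable_l1_normB.
    exact: (measurableT_comp measurable_fst measurable_fst).
  exact: (measurableT_comp measurable_fst measurable_snd).
have msd i : measurable_fun setT (fun x : V => (second_diff f (e i) x)%:E).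
  apply/measurable_EFinP; apply: l1_lipschitz_measurable.
  exact: second_diff_lipschitz fL.
have msd1 i : measurable_fun setT (fun z : V * V => (second_diff f (e i) z.1)%:E).
  exact: (measurableT_comp (msd i) measurable_fst).
have msd2 i : measurable_fun setT
    (fun z : (V * V) * (V * V) => (second_diff f (e i) z.1.1)%:E).
  exact: (measurableT_comp (msd1 i) measurable_fst).
have mgap : measurable_fun setT (duality_gap phi) by exact: measurable_duality_gap phil.
have mF1 : measurable_fun setT F1 by apply: measurable_funeM; exact: ml1.
have mF2 : measurable_fun setT F2.
  by apply: emeasurable_sum => i; exact: measurable_funeM.
have mF3 : measurable_fun setT F3.
  by apply: measurable_funeM; exact: (measurableT_comp mgap measurable_snd).
have gap0 z : (0 <= duality_gap phi z)%E by exact: duality_gap_ge0.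
have F10 z : (0 <= F1 z)%E by rewrite mule_ge0 ?lee_fin.
have F20 z : (0 <= F2 z)%E.
  by apply: sume_ge0 => i _; rewrite mule_ge0 ?lee_fin.
have brd0 : 0 <= 2 * b / r * d%:R by exact: mulr_ge0.
have F30 z : (0 <= F3 z)%E by apply: mule_ge0; [rewrite lee_fin|exact: gap0].
apply: (@le_trans _ _ (\int[G]_z (F1 z + F2 z + F3 z))%E).
  apply: ae_ge0_le_integral => //.
  - by move=> z _; rewrite lee_fin sqr_ge0.
  - exact: measurable_eucl_dist_prod_sqr.
  - by move=> z _; rewrite !adde_ge0.
  - by apply: emeasurable_funD => //; exact: emeasurable_funD.
  exists (~` (S `*` St)); split.
  - by apply: measurableC; exact: measurableX.
  - exact: (concentrated_coupling mS mSt gS gSt Gc).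
  move=> [[x y] [xt yt]] /= h [/= Sz Stz]; apply: h => _.
  have [/= xa yb] := Sab _ Sz; have [/= xta ytb] := Stab _ Stz.
  have := SE _ Sz => /=.
  have := phifin _ (eucl_ball_le a4 xa); have := psifin _ (eucl_ball_le b4 yb).
  have := fphi x; case: (phi x) => // p0 /(_ _ erefl) fp0.
  rewrite -[fenchel_conj phi y]fineK; last exact: psifin _ (eucl_ball_le b4 yb).
  rewrite -/(c y) -EFinD => _ _ [pc].
  rewrite /F1 /F2 /F3 /duality_gap /l1 /=.
  have := phifin _ (eucl_ball_le a4 xta).
  have := fphi xt; case: (phi xt) => // pt /(_ _ erefl) fpt _.
  rewrite -[fenchel_conj phi yt]fineK; last exact: psifin _ (eucl_ball_le b4 ytb).
  rewrite -/(c yt); pose er := pt + c yt - dotp xt yt.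
  rewrite (_ : (pt%:E + (c yt)%:E - (dotp xt yt)%:E)%E = er%:E)//.
  rewrite (eq_bigr (fun i => (2 * b / r * second_diff f (e i) x)%:E)); last first.
    by move=> i _; rewrite EFinM.
  rewrite sumEFin -!EFinM -!EFinD lee_fin /eucl_dist_prod /=.
  rewrite sqr_sqrtr; last by rewrite addr_ge0 ?sqr_ge0.
  have hx := ball_sqr_dist_le_l1 xa xta.
  have hy := ball_sqr_dist_le_l1 yb ytb.
  have hi : l1_norm (y - yt) <= r^-1 * (\sum_(i < d) second_diff f (e i) x +
      d%:R * er + d%:R * (2 * b * l1_norm (x - xt))).
    rewrite ler_pdivlMl// {1}/l1_norm mulr_sumr.
    rewrite (_ : _ + _ + _ = \sum_(i < d) (second_diff f (e i) x + er +
      2 * b * l1_norm (x - xt))); last first.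
      rewrite [RHS]big_split [X in _ = X + _]big_split /= !sumr_const card_ord.
      by rewrite -(mulr_natl er) -(mulr_natl (2 * b * _)).
    apply: ler_sum => i _; rewrite coordB.
    apply: (@subgradient_displacement _ _ c b K b0 cK x y xt yt pt) => //.
      by rewrite -pc addrK.
    exact: ltW.
  have hb : 2 * b * l1_norm (y - yt) <= 2 * b * (r^-1 * (\sum_(i < d) second_diff f (e i) x +
      d%:R * er + d%:R * (2 * b * l1_norm (x - xt)))).
    by rewrite ler_wpM2l// mulr_ge0// ltW.
  rewrite -mulr_sumr; apply: le_trans (lerD hx (le_trans hy hb)) _.
  by rewrite le_eqVlt; apply/orP; left; apply/eqP; rewrite /A; ring.
rewrite ge0_integralD//; last 2 first.
- by move=> z _; rewrite adde_ge0.
- exact: emeasurable_funD.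
rewrite ge0_integralD// !EFinD; apply: leeD; first apply: leeD.
- rewrite ge0_integralZl ?lee_fin//; last by move=> z _; rewrite lee_fin.
  by rewrite [leRHS]EFinM; apply: lee_wpmul2l; [rewrite lee_fin|exact: Gs].
- rewrite ge0_integral_sum//; last 2 first.
  + by move=> i; exact: measurable_funeM.
  + by move=> i z _; rewrite mule_ge0 ?lee_fin.
  apply: (@le_trans _ _ (\sum_(i < d) ((2 * b / r * (M * (2 * a) ^+ d / (2 * a) * b *
      (4 * d%:R + 2) * r ^+ 2))%:E))%E); last first.
    by rewrite sumEFin lee_fin sumr_const card_ord -[leLHS]mulr_natl.
  apply: lee_sum => i _; rewrite ge0_integralZl ?lee_fin//; last first.
    by move=> z _; rewrite lee_fin.
  rewrite [leRHS]EFinM; apply: lee_wpmul2l; first by rewrite lee_fin.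
  rewrite (ge0_integral_coupling_fst Gc (msd1 i)); last by move=> z; rewrite lee_fin.
  rewrite (ge0_integral_coupling_fst gc (msd i)); last by move=> z; rewrite lee_fin.
  by apply: (integral_second_diff_le i a0 N0 (ltW b0) (ltW M0) muc muM fL f2 rE).
rewrite ge0_integralZl ?lee_fin//; last first.
  exact: (measurableT_comp mgap measurable_snd).
by rewrite (ge0_integral_coupling_snd Gc mgap)// gapE -EFinM.
Qed.

(** For t <= 1 the linear rate dominates and E <= sqrt E; for t > 1 the sum
    s + sqrt E is at least 1/2, and the a priori bound D0 on X is enough. *)
Lemma sqr_le_of_rates (X C1 D0 E s t : R) : 0 <= X -> 0 <= C1 -> 0 <= E -> 0 < s ->
  X <= D0 -> 0 <= t -> t ^+ 2 = E + s -> X <= C1 * (t + t ^+ 2) ->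
  X ^+ 2 <= (4 * C1 ^+ 2 + 2 * D0 ^+ 2) * (s + Num.sqrt E).
Proof.
move=> X0 C10 E0 s0 XD t0 tE XC.
have q0 := sqrtr_ge0 E; have qE := sqr_sqrtr E0; set q := Num.sqrt E in q0 qE *.
have D00 : 0 <= D0 by exact: le_trans XD.
have X2D : X ^+ 2 <= D0 ^+ 2 by rewrite ler_pXn2r.
have [t1|t1] := lerP t 1.
  have t2 : t ^+ 2 <= t by rewrite expr2 ler_piMl.
  have hX : X <= 2 * C1 * t by apply: le_trans XC _; rewrite -mulrA mulrCA ler_wpM2l//; lra.
  have : X ^+ 2 <= (2 * C1 * t) ^+ 2 by rewrite ler_pXn2r// nnegrE !mulr_ge0.
  rewrite exprMn tE => h; apply: le_trans h _.
  have E1 : E <= q.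
    have q1 : q <= 1.
      have : q ^+ 2 <= 1 ^+ 2 by rewrite qE expr1n; move: tE t2; lra.
      by rewrite ler_pXn2r// nnegrE.
    by rewrite -qE expr2 ler_piMl.
  rewrite exprMn -natrX /= (_ : (2 ^ 2)%N = 4%N)// -[X in _ * X]addr0.
  apply: ler_pM; rewrite ?addr0 ?mulr_ge0 ?sqr_ge0 ?addr_ge0 ?(ltW s0)//.
    by rewrite lerDl mulr_ge0 ?sqr_ge0.
  by rewrite addrC lerD2l.
have hq : 2^-1 <= s + q.
  have : 1 < E + s by rewrite -tE expr_gt1.
  by have [|] := lerP 2^-1 s; [lra|move=> h1 h2; nra].
apply: le_trans X2D _.
apply: (@le_trans _ _ (2 * D0 ^+ 2 * 2^-1)); first by rewrite mulrAC divff ?mul1r.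
apply: ler_pM; rewrite ?mulr_ge0 ?sqr_ge0 ?invr_ge0//.
by rewrite lerDr mulr_ge0 ?sqr_ge0.
Qed.

End estimate.

Section conclusion.
Context (R : realType) (d : nat).
Local Notation V := ('rV[R]_d).

(** As the gap of psi vanishes on S, subtracting psi and its conjugate amounts to
    subtracting the inner product. *)
Lemma integral_duality_gap (mu nu : probability V R) (g : probability (V * V)%type R)
    (phi psi : V -> \bar R) (a b : R) (S : set (V * V)) :
  0 < a -> 0 < b -> lipschitz_class (4 * a) (4 * b) phi ->
  lipschitz_class (4 * a) (4 * b) psi -> coupling mu nu g ->
  measurable S -> g (~` S) = 0%E ->
  (forall z, S z -> eucl_ball a z.1 /\ eucl_ball b z.2) ->
  (forall z, S z -> (psi z.1 + fenchel_conj psi z.2 = (dotp z.1 z.2)%:E)%E) ->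
  exists E : R, [/\ 0 <= E,
    (\int[g]_z duality_gap phi z = E%:E)%E &
    (\int[mu]_x (phi x - psi x) +
     \int[nu]_y (fenchel_conj phi y - fenchel_conj psi y) = E%:E)%E].
Proof.
move=> a0 b0 [[phip phil _] phiL phiL'] [[psip psil _] psiL psiL'] gc mS gS Sab SE.
have a4 : a <= 4 * a by lra.
have b4 : b <= 4 * b by lra.
have [K1 phiK] := lipschitz_real_on_bounded (lt_le_trans a0 a4) phiL.
have [K2 phiK'] := lipschitz_real_on_bounded (lt_le_trans b0 b4) phiL'.
have [K3 psiK] := lipschitz_real_on_bounded (lt_le_trans a0 a4) psiL.
have [K4 psiK'] := lipschitz_real_on_bounded (lt_le_trans b0 b4) psiL'.
pose K := `|K1| + `|K2| + `|K3| + `|K4|.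
have mphi := lower_semicontinuous_rV_measurable phil.
have mpsi := lower_semicontinuous_rV_measurable psil.
have mphi' := @measurable_fenchel_conj _ _ phi.
have mpsi' := @measurable_fenchel_conj _ _ psi.
have bd (u v : \bar R) (k l : R) : (`|u| <= k%:E -> `|v| <= l%:E ->
    (k + l <= K)%R -> `|u - v| <= K%:E)%E.
  case: u => [u| |]//; case: v => [v| |]//; rewrite /abse/= !lee_fin => uk vl kl.
  by apply: le_trans (ler_normB _ _) _; apply: le_trans kl; exact: lerD.
have mu1 : measurable_fun setT (fun x => phi x - psi x)%E by exact: emeasurable_funB.
have mv1 : measurable_fun setT (fun y => fenchel_conj phi y - fenchel_conj psi y)%E.
  exact: emeasurable_funB.
have [iu iv ->] := @integral_marginals _ _ _ _ R mu nu g _ _ S K gc mu1 mv1 mS gS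
  (fun z Sz => bd _ _ _ _ (phiK _ (eucl_ball_le a4 (Sab z Sz).1))
    (psiK _ (eucl_ball_le a4 (Sab z Sz).1)) ltac:(
     rewrite /K; have := ler_norm K1; have := ler_norm K3;
     have := normr_ge0 K2; have := normr_ge0 K4; lra))
  (fun z Sz => bd _ _ _ _ (phiK' _ (eucl_ball_le b4 (Sab z Sz).2))
    (psiK' _ (eucl_ball_le b4 (Sab z Sz).2)) ltac:(
     rewrite /K; have := ler_norm K2; have := ler_norm K4;
     have := normr_ge0 K1; have := normr_ge0 K3; lra)).
have gapE : (\int[g]_z (phi z.1 - psi z.1 +
    (fenchel_conj phi z.2 - fenchel_conj psi z.2)) = \int[g]_z duality_gap phi z)%E.
  apply: ae_eq_integral => //.
  - apply: emeasurable_funD.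
      exact: (measurableT_comp mu1 measurable_fst).
    exact: (measurableT_comp mv1 measurable_snd).
  - exact: measurable_duality_gap.
  exists (~` S); split => //; first exact: measurableC.
  move=> z /= h Sz; apply: h => _; have := SE z Sz; rewrite /duality_gap.
  have [z1 z2] := Sab z Sz.
  have := psiL.1 _ (eucl_ball_le a4 z1); have := psiL'.1 _ (eucl_ball_le b4 z2).
  have := phiL.1 _ (eucl_ball_le a4 z1); have := phiL'.1 _ (eucl_ball_le b4 z2).
  case: (phi z.1) => // p; case: (fenchel_conj phi z.2) => // p'.
  case: (psi z.1) => // q; case: (fenchel_conj psi z.2) => // q' _ _ _ _.
  move=> -[<-].
  apply: (congr1 EFin (x := p - q + (p' - q')) (y := p + p' - (q + q'))); ring.
have gap0 : (0 <= \int[g]_z duality_gap phi z)%E.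
  by apply: integral_ge0 => z _; exact: duality_gap_ge0.
have gapfin : (\int[g]_z duality_gap phi z)%E \is a fin_num.
  by rewrite -gapE; exact: integrable_fin_num (integrableD measurableT iu iv).
rewrite gapE; exists (fine (\int[g]_z duality_gap phi z)%E); rewrite fineK//.
by split => //; exact: fine_ge0.
Qed.

(** Fitting the grid forces r to be of the form 2a/N, hence only comparable with the
    optimal t. *)
Lemma scale_choice (a b E s t K : R) : 0 < a -> 0 < b -> 0 <= E -> 0 < s -> 0 < t ->
  t ^+ 2 = E + s -> 0 <= K ->
  exists2 N, (0 < N)%N & forall r, r = 2 * a / N%:R ->
  (2 * a + 2 * b / r * (2 * b * d%:R)) * s + d%:R * (2 * b / r * (K * r ^+ 2)) +
    2 * b / r * d%:R * E <=
  (2 * a + 2 * b * d%:R * ((2 * b + 1) * (1 + (2 * a)^-1) + K)) * (t + t ^+ 2).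
Proof.
move=> a0 b0 E0 s0 t0 tE K0.
pose N := (Num.truncn (2 * a / t)).+1; exists N => // r rE.
have N0 : 0 < N%:R :> R by rewrite ltr0n.
have r0 : 0 < r by rewrite rE divr_gt0// mulr_gt0.
have rt : r <= t.
  rewrite rE ler_pdivrMr// (mulrC t) -ler_pdivrMr//; exact/ltW/truncnS_gt.
have rV : r^-1 <= t^-1 + (2 * a)^-1.
  rewrite rE invf_div ler_pdivrMr ?mulr_gt0// mulrDl mulVf ?gt_eqF ?mulr_gt0//.
  rewrite /N -natr1 lerD2r (mulrC t^-1) truncn_le.
  by rewrite divr_ge0 ?mulr_ge0// ltW.
have db0 : 0 <= 2 * b * d%:R by rewrite !mulr_ge0// ltW.
have tV : t ^+ 2 * t^-1 = t by rewrite expr2 mulfK// gt_eqF.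
have h1 : 2 * a * s <= 2 * a * (t + t ^+ 2).
  by rewrite ler_wpM2l ?mulr_ge0 ?(ltW a0)// tE; lra.
have h2 : (2 * b * s + E) * r^-1 <= (2 * b + 1) * (1 + (2 * a)^-1) * (t + t ^+ 2).
  apply: (@le_trans _ _ ((2 * b + 1) * t ^+ 2 * (t^-1 + (2 * a)^-1))).
    apply: ler_pM => //; rewrite ?invr_ge0 ?(ltW r0)//.
      by rewrite addr_ge0// !mulr_ge0// ltW.
    by rewrite tE; nra.
  rewrite -[leLHS]mulrA -[leRHS]mulrA ler_wpM2l ?addr_ge0 ?mulr_ge0 ?(ltW b0)//.
  rewrite [leLHS]mulrDr tV.
  have : 0 <= (2 * a)^-1 by rewrite invr_ge0 mulr_ge0// ltW.
  by move: (2 * a)^-1 => u u0; have := sqr_ge0 t; nra.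
have h3 : K * r <= K * (t + t ^+ 2).
  by rewrite ler_wpM2l//; have := sqr_ge0 t; lra.
have -> : (2 * a + 2 * b / r * (2 * b * d%:R)) * s + d%:R * (2 * b / r * (K * r ^+ 2)) +
    2 * b / r * d%:R * E =
    2 * a * s + 2 * b * d%:R * ((2 * b * s + E) * r^-1 + K * r).
  by field; rewrite gt_eqF.
rewrite [leRHS]mulrDl lerD// -[leRHS]mulrA ler_wpM2l// [leRHS]mulrDl; exact: lerD.
Qed.

End conclusion.

Theorem theorem5p3 (R : realType) (d : nat) (Rmu Rnu M : R) :
  (0 < d)%N -> 0 < Rmu -> 0 < Rnu -> 0 < M ->
  exists C : R, 0 < C /\
  forall (mu nu : probability 'rV[R]_d R)
         (phi : 'rV[R]_d -> \bar R)
         (gamma : probability ('rV[R]_d * 'rV[R]_d)%type R)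
         (mut nut : probability 'rV[R]_d R)
         (phit : 'rV[R]_d -> \bar R)
         (gammat : probability ('rV[R]_d * 'rV[R]_d)%type R),
  concentrated_on mu (eucl_ball Rmu) ->
  concentrated_on nu (eucl_ball Rnu) ->
  (forall A : set 'rV[R]_d, measurable A -> (mu A <= M%:E * lebesgue_rV A)%E) ->
  lipschitz_class (4 * Rmu) (4 * Rnu) phi ->
  optimal_brenier_potential mu nu phi ->
  optimal_coupling mu nu gamma ->
  concentrated_on mut (eucl_ball Rmu) ->
  concentrated_on nut (eucl_ball Rnu) ->
  lipschitz_class (4 * Rmu) (4 * Rnu) phit ->
  optimal_brenier_potential mut nut phit ->
  optimal_coupling mut nut gammat ->
  ((1 / C ^+ 4)%:E * W2 (@eucl_dist_prod R d) gamma gammat ^+ 4 <=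
   W2 (@eucl_dist R d) mu mut +
   sqrte (\int[mut]_x (phi x - phit x) +
          \int[nut]_y (fenchel_conj phi y - fenchel_conj phit y)))%E.
Proof.
move=> d0 a0 b0 M0; set a := Rmu in a0 *; set b := Rnu in b0 *.
have [a0' b0'] := (ltW a0, ltW b0).
pose KL := M * (2 * a) ^+ d / (2 * a) * b * (4 * d%:R + 2).
pose C1 := 2 * a + 2 * b * d%:R * ((2 * b + 1) * (1 + (2 * a)^-1) + KL).
pose D0 := 2 * a * (d%:R * (2 * a)) + 2 * b * (d%:R * (2 * b)).
pose K0 := 4 * C1 ^+ 2 + 2 * D0 ^+ 2.
pose kap := (d%:R + 1) / 2 + 1 : R.
have K00 : 0 <= K0 by rewrite addr_ge0// mulr_ge0// sqr_ge0.
have kap1 : 1 <= kap by rewrite lerDr divr_ge0// addr_ge0.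
have KL0 : 0 <= KL.
  by rewrite /KL !mulr_ge0 ?invr_ge0 ?mulr_ge0 ?exprn_ge0 ?mulr_ge0 ?addr_ge0 ?mulr_ge0// ltW.
have C10 : 0 <= C1.
  apply: addr_ge0; first exact: mulr_ge0.
  apply: mulr_ge0; first by rewrite !mulr_ge0.
  by rewrite addr_ge0// mulr_ge0// addr_ge0 ?mulr_ge0// invr_ge0 mulr_ge0.
pose C := K0 * kap + 1.
have kap0 : 0 <= kap by apply: le_trans kap1.
have C1' : 1 <= C by rewrite lerDr mulr_ge0.
have C0 : 0 < C by apply: lt_le_trans C1'.
exists C; split => // mu nu phi g mut nut psi gt cmu cnu muM phiL phio go
  cmut cnut psiL psio gto.
have [S [mS gS Sab SE]] := optimal_potential_complementary a0 b0 cmu cnu go phiL phio.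
have [St [mSt gSt Stab StE]] :=
  optimal_potential_complementary a0 b0 cmut cnut gto psiL psio.
have [E [E0 gapE ->]] := integral_duality_gap a0 b0 phiL psiL gto.1 mSt gSt Stab StE.
rewrite [sqrte E%:E]/=.
pose I2 := ereal_inf [set (\int[p]_z (eucl_dist z.1 z.2 ^+ 2)%:E)%E | p in coupling mu mut].
have I20 : (0 <= I2)%E.
  apply: le_ereal_inf_tmp => _ [p _ <-].
  by apply: integral_ge0 => z _; rewrite lee_fin sqr_ge0.
rewrite {2}/W2 -/I2.
have := sqr_sqrte I20; have := sqrte_ge0 I2.
case: (sqrte I2) => [w| |]//; last by move=> _ _; rewrite addye// leey.
rewrite lee_fin => w0 wI.
pose I4 := ereal_inf [set (\int[G]_z (eucl_dist_prod z.1 z.2 ^+ 2)%:E)%E | G in coupling g gt].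
have I40 : (0 <= I4)%E.
  apply: le_ereal_inf_tmp => _ [p _ <-].
  by apply: integral_ge0 => z _; rewrite lee_fin sqr_ge0.
rewrite /W2 -/I4.
(* A coupling of cost less than s^2 is at hand for s > w only; s tends to w below. *)
have key s : w < s -> exists X : R, [/\ I4 = X%:E, 0 <= X &
    X ^+ 2 <= K0 * (kap * s + Num.sqrt E)].
  move=> ws; have s0 : 0 < s by exact: le_lt_trans ws.
  have : (I2 < (s ^+ 2)%:E)%E.
    by rewrite -wI -EFin_expe lte_fin ltrXn2r// ?nnegrE ?ltW.
  move=> /ereal_inf_lt[_ [p pc <-] ps].
  have [G [Gc Gl1]] := glue_couplings a0 s0 cmu cmut go.1 gto.1 pc.
  have Gs : (\int[G]_z (l1_norm (z.1.1 - z.2.1))%:E <= (kap * s)%:E)%E.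
    apply: le_trans Gl1 _.
    apply: (@le_trans _ _ (((d%:R + 1) / 2 * s)%:E + s%:E)%E); last first.
      rewrite -EFinD lee_fin (_ : kap * s = (d%:R + 1) / 2 * s + s)//.
      by rewrite /kap; ring.
    apply: leeD => //.
    pose D (z : 'rV[R]_d * 'rV[R]_d) := ((eucl_dist z.1 z.2) ^+ 2)%:E.
    have mD : measurable_fun setT D.
      apply/measurable_EFinP; apply: measurable_eucl_dist_sqr.
        exact: measurable_fst.
      exact: measurable_snd.
    have D0' z : (0 <= D z)%E by rewrite lee_fin sqr_ge0.
    have sV : 0 <= (2 * s)^-1 by rewrite invr_ge0 mulr_ge0// ltW.
    have ds : 0 <= d%:R * s / 2 by rewrite divr_ge0// mulr_ge0// ltW.
    apply: (@le_trans _ _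
        (\int[p]_z (((2 * s)^-1)%:E * D z + cst (d%:R * s / 2)%:E z))%E).
      apply: ge0_le_integral => //.
      - by move=> z _; rewrite lee_fin l1_norm_ge0.
      - apply/measurable_EFinP; apply: measurable_l1_normB.
          exact: measurable_fst.
        exact: measurable_snd.
      - by apply: emeasurable_funD => //; exact: measurable_funeM.
      by move=> z _; rewrite /D /= -EFinM -EFinD lee_fin; exact: l1_norm_le_sqr_dist.
    rewrite ge0_integralD//; last 2 first.
    - by move=> z _; apply: mule_ge0 => //; rewrite lee_fin.
    - exact: measurable_funeM.
    have -> : (\int[p]_x cst (d%:R * s / 2)%:E x = (d%:R * s / 2)%:E)%E.
      rewrite integral_cst// -[RHS]mule1; congr (_ * _)%E; exact: probability_setT.
    rewrite ge0_integralZl ?lee_fin//.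
    apply: (@le_trans _ _ (((2 * s)^-1)%:E * (s ^+ 2)%:E + (d%:R * s / 2)%:E)%E).
      by rewrite leeD2r// lee_wpmul2l ?lee_fin// ltW.
    rewrite -EFinM -EFinD lee_fin le_eqVlt; apply/orP; left; apply/eqP.
    by field; rewrite gt_eqF.
  have s10 : 0 < kap * s by rewrite mulr_gt0// (lt_le_trans _ kap1).
  pose t := Num.sqrt (E + kap * s).
  have t0 : 0 < t by rewrite sqrtr_gt0 ltr_wpDl.
  have tE : t ^+ 2 = E + kap * s by rewrite sqr_sqrtr// addr_ge0// ltW.
  have [N N0 hN] := scale_choice d a0 b0 E0 s10 t0 tE KL0.
  have := coupling_cost_le a0 b0 M0 N0 erefl cmu muM phiL go.1 mS gS Sab SE mSt
    gSt Stab gapE Gc Gs.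
  have IG : (I4 <= \int[G]_z (eucl_dist_prod z.1 z.2 ^+ 2)%:E)%E.
    by apply: ereal_inf_lbound; exists G.
  move=> /(le_trans IG) IG1.
  have ID : (I4 <= D0%:E)%E.
    apply: le_trans IG _; rewrite -[leRHS]mule1 -(probability_setT G).
    apply: (le_integral_cst (A := S `*` St)).
    - exact: measurableX.
    - exact: (concentrated_coupling mS mSt gS gSt Gc).
    - exact: measurable_eucl_dist_prod_sqr.
    - by move=> z; rewrite lee_fin sqr_ge0.
    - by rewrite lee_fin addr_ge0// !mulr_ge0.
    move=> [[x y] [xt yt]] [/= /Sab[/= xa yb] /Stab[/= xta ytb]].
    rewrite lee_fin sqr_sqrtr; last by rewrite addr_ge0 ?sqr_ge0.
    by apply: lerD; [exact: ball_sqr_dist_le xa xta|exact: ball_sqr_dist_le yb ytb].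
  have IX : I4 = (fine I4)%:E.
    by rewrite fineK// ge0_fin_numE// (le_lt_trans ID)// ltry.
  exists (fine I4); split => //; first exact: fine_ge0.
  apply: (@sqr_le_of_rates _ _ C1 D0 E (kap * s) t) => //.
  - exact: fine_ge0.
  - by rewrite -lee_fin -IX.
  - exact: ltW.
  by rewrite -lee_fin -IX; apply: le_trans IG1 _; rewrite lee_fin; exact: hN.
have [X [IX X0 _]] := key (w + 1) ltac:(lra).
have X2 : X ^+ 2 <= K0 * (kap * w + Num.sqrt E).
  apply: (ler_lim_harmonic (K := K0 * kap)) => n.
  have wn : w < w + n.+1%:R^-1 by rewrite ltrDl invr_gt0 ltr0n.
  have [X' [IX' _ h]] := key _ wn.
  move: IX'; rewrite IX => -[->]; apply: le_trans h _.
  by rewrite le_eqVlt; apply/orP; left; apply/eqP; ring.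
have q0 := sqrtr_ge0 E.
rewrite IX [sqrte X%:E]/= -EFin_expe -EFinM -EFinD lee_fin.
rewrite (exprM (Num.sqrt X) 2 2) sqr_sqrtr// mulrC mul1r ler_pdivrMr ?exprn_gt0//.
apply: le_trans X2 _.
apply: (@le_trans _ _ (K0 * kap * (w + Num.sqrt E))).
  rewrite -mulrA ler_wpM2l// mulrDr lerD2l ler_peMl//.
rewrite mulrC ler_wpM2l ?addr_ge0//.
apply: (@le_trans _ _ C); first by rewrite lerDl.
by rewrite -[leLHS]expr1 ler_weXn2l.
Qed.
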